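(* (1) The AF algebra $C(\omega+1)$ is not computably categorical; that is, it has two computable presentations that are not computably $*$-isomorphic. (2) There is a unital dimension group that has two c.e. presentations that are not computably isomorphic. (3) There exist two computably presentable Bratteli diagrams that are equivalent but not computably equivalent.
   Context: $C(\omega+1)$ is the C*-algebra of continuous complex-valued functions on the ordinal $\omega+1$ with its order topology. C*-algebra presentations. A presentation $\mathbf{A}^\#$ of a C*-algebra $\mathbf{A}$ is a sequence in $\mathbf{A}$ (special points) generating a dense $*$-subalgebra; generated points are the values of $*$-polynomials over $\mathbb{Q}(i)$ at special points, effectively listed. $\mathbf{A}^\#$ is computable if there is an algorithm that, given a generated point $q$ and $k$, outputs a rational within $2^{-k}$ of $\|q\|$. A $*$-homomorphism $\phi$ is computable from $\mathbf{A}^\#$ to $\mathbf{B}^\#$ if an algorithm, given a generated point $q$ of $\mathbf{A}^\#$ and $k$, returns a generated point of $\mathbf{B}^\#$ within $2^{-k}$ of $\phi(q)$. Computably $*$-isomorphic means there is a computable $*$-isomorphism. Groups. An ordered abelian group is $(G,P)$ with $G$ abelian and $P$ closed under addition, $P\cap(-P)=\{0\}$, $P+(-P)=G$; an order unit is $u\in P$ such that for every $g$ some positive integer $n$ satisfies $-nu\le g\le nu$. A dimension group is an inductive limit, in the category of ordered abelian groups and positive homomorphisms, of a sequence of groups $\mathbb{Z}^{n_s}$ with cones $\mathbb{Z}^{n_s}_{\ge0}$; a unital dimension group has a distinguished order unit. A presentation of $((G,P),u)$ is given by an epimorphism $\nu:F_\omega\to G$ from the free group on $x_0,x_1,\dots$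 (identified computably with $\mathbb{N}$); it is c.e. if $\ker\nu$ and $\nu^{-1}[P]$ are c.e.; $w$ is a label of $\nu(w)$. Two presentations are computably isomorphic if there is an isomorphism of unital ordered groups for which an algorithm transforms any label of a point into a label of its image. Bratteli diagrams. A Bratteli diagram $\mathcal{D}$ consists of a vertex set $V_{\mathcal{D}}$, a level function $L_{\mathcal{D}}:V_{\mathcal{D}}\to\mathbb{N}$ with finite fibers, and an edge function $E_{\mathcal{D}}:V_{\mathcal{D}}\times V_{\mathcal{D}}\to\mathbb{N}$ such that $E_{\mathcal{D}}(u,v)>0$ implies $L_{\mathcal{D}}(v)=L_{\mathcal{D}}(u)+1$; it may also carry a labeling $\Lambda_{\mathcal{D}}:V_{\mathcal{D}}\to\mathbb{N}$ (a labeled Bratteli diagram is regarded as a kind of Bratteli diagram). A presentation is a surjection $\nu:\mathbb{N}\to V_{\mathcal{D}}$; it is computable if $\{(m,n):\nu(m)=\nu(n)\}$, $L_{\mathcal{D}}\circ\nu$, $(m,n)\mapsto E_{\mathcal{D}}(\nu(m),\nu(n))$, $\Lambda_{\mathcal{D}}\circ\nu$ (if labeled) and $n\mapsto\#L_{\mathcal{D}}^{-1}[\{n\}]$ are computable; $\mathcal{D}$ is computably presentable if it has a computable presentation. $P_{\mathcal{D}}(u,v)$ denotes the number of paths from $u$ to $v$ (counted with edge multiplicities, along strictly increasing consecutive levels; $0$ if $L_{\mathcal{D}}(u)\ge L_{\mathcal{D}}(v)$). $\mathcal{D}$ is a telescoping of $\mathcal{D}'$ if there is an increasing sequence of integers $(n_k)_{k\in\mathbb{N}}$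 with $n_0=0$, $L_{\mathcal{D}}^{-1}[\{k\}]=L_{\mathcal{D}'}^{-1}[\{n_k\}]$, $E_{\mathcal{D}}(u,v)=P_{\mathcal{D}'}(u,v)$ (for $u,v$ in consecutive levels of $\mathcal{D}$), and, if labeled, $\Lambda_{\mathcal{D}}(v)=\Lambda_{\mathcal{D}'}(v)$; it is a computable telescoping if such $(n_k)_k$ can be taken computable. $\mathcal{D}$ and $\mathcal{D}'$ are equivalent (resp. computably equivalent) if there is a finite sequence $\mathcal{D}_0=\mathcal{D},\dots,\mathcal{D}_m=\mathcal{D}'$ of Bratteli diagrams such that for each $j<m$, $\mathcal{D}_j$ and $\mathcal{D}_{j+1}$ are isomorphic or one is a telescoping (resp. computable telescoping) of the other. *)

(* Defs.v *)
From HB Require Import structures.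
From Stdlib Require Arith.Cantor.
From mathcomp Require Import all_boot all_order all_algebra.
From mathcomp Require Import complex.
From mathcomp Require Import all_classical all_reals all_analysis.
Set Implicit Arguments.
Unset Strict Implicit.
Unset Printing Implicit Defensive.
Import Order.TTheory GRing.Theory Num.Theory numFieldNormedType.Exports Normc.
Local Open Scope classical_set_scope.
Local Open Scope ring_scope.

Definition npair (m n : nat) : nat := Arith.Cantor.to_nat (m, n).

(* Partial recursive functions, as unary functions on nat; several arguments
   are passed as iterated Cantor pairs (npair is a bijection), so that
   PPair PFst PSnd is the identity. *)
Inductive prog : Type :=
| PZero | PSucc | PFst | PSnd
| PPair of prog & prog
| PComp of prog & prog
| PRec of prog & prog
| PMu of prog.

(* In EvMu, w m + 1 is the nonzero value of p at (a, m). *)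
Inductive peval : prog -> nat -> nat -> Prop :=
| EvZero n : peval PZero n 0
| EvSucc n : peval PSucc n n.+1
| EvFst m n : peval PFst (npair m n) m
| EvSnd m n : peval PSnd (npair m n) n
| EvPair p q n a b :
    peval p n a -> peval q n b -> peval (PPair p q) n (npair a b)
| EvComp p q n a b : peval q n a -> peval p a b -> peval (PComp p q) n b
| EvRec0 p q a b : peval p a b -> peval (PRec p q) (npair a 0) b
| EvRecS p q a n b c :
    peval (PRec p q) (npair a n) b ->
    peval q (npair a (npair n b)) c ->
    peval (PRec p q) (npair a n.+1) c
| EvMu p a n (w : nat -> nat) :
    (forall m, (m < n)%N -> peval p (npair a m) (w m).+1) ->
    peval p (npair a n) 0 ->
    peval (PMu p) a n.

(* Each instance below has a computable image, so that computability with
   respect to code does not depend on inputs that are not codes. *)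
Class coded (T : Type) := Coded { code : T -> nat; code_inj : injective code }.

#[global] Instance coded_nat : coded nat := Coded (@inj_id nat).

Fact code_bool_inj : injective nat_of_bool. Proof. by case=> [] []. Qed.
#[global] Instance coded_bool : coded bool := Coded code_bool_inj.

Lemma npair_inj m n m' n' : npair m n = npair m' n' -> m = m' /\ n = n'.
Proof. by move/Arith.Cantor.to_nat_inj => [-> ->]. Qed.

Definition code_prod {A B : Type} {cA : coded A} {cB : coded B} (x : A * B) :=
  npair (code x.1) (code x.2).
Fact code_prod_inj (A B : Type) (cA : coded A) (cB : coded B) :
  injective (@code_prod A B cA cB).
Proof.
move=> [a b] [a' b']; rewrite /code_prod /= => /npair_inj[aa bb].
by rewrite (code_inj aa) (code_inj bb).
Qed.
#[global] Instance coded_prod (A B : Type) (cA : coded A) (cB : coded B) :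
  coded (A * B) := Coded (@code_prod_inj A B cA cB).

Fixpoint code_seq {A : Type} {cA : coded A} (s : seq A) : nat :=
  if s is a :: s' then (npair (code a) (code_seq s')).+1 else 0%N.
Fact code_seq_inj (A : Type) (cA : coded A) : injective (@code_seq A cA).
Proof.
by elim=> [|a s IH] [|b t] //= [/npair_inj[ab st]]; rewrite (code_inj ab) (IH t).
Qed.
#[global] Instance coded_seq (A : Type) (cA : coded A) : coded (seq A) :=
  Coded (@code_seq_inj A cA).

Definition code_int (z : int) : nat :=
  match z with Posz n => n.*2 | Negz n => n.*2.+1 end.
Fact code_int_inj : injective code_int.
Proof.
case=> m [] n /= mn; have := congr1 odd mn; have := congr1 half mn;
  rewrite /= ?uphalf_double ?doubleK ?odd_double //; by move=> ->.
Qed.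
#[global] Instance coded_int : coded int := Coded code_int_inj.

Definition computable {A B : Type} {cA : coded A} {cB : coded B}
    (f : A -> B) : Prop :=
  exists p : prog, forall x, peval p (code x) (code (f x)).

Definition computable_pred {A : Type} {cA : coded A} (S : A -> Prop) : Prop :=
  computable (fun x => `[< S x >]).

Definition computably_enumerable {A : Type} {cA : coded A}
    (S : A -> Prop) : Prop :=
  exists p : prog, forall x, S x <-> exists y, peval p (code x) y.

(* C*-algebras are not assumed to be unital, hence the separate product cmul. *)
HB.mixin Record isCStarAlgebra (K : numClosedFieldType) A
    & CompleteNormedModule K A := {
  cmul : A -> A -> A;
  star : A -> A;
  cmulA : associative cmul;
  cmulDl : left_distributive cmul +%R;
  cmulDr : right_distributive cmul +%R;
  cmulZl : forall (c : K) (x y : A), cmul (c *: x) y = c *: cmul x y;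
  cmulZr : forall (c : K) (x y : A), cmul x (c *: y) = c *: cmul x y;
  starK : involutive star;
  starD : {morph star : x y / x + y};
  starZ : forall (c : K) (x : A), star (c *: x) = c^* *: star x;
  starM : {morph star : x y / cmul x y >-> cmul y x};
  cnormM : forall x y : A, `|cmul x y| <= `|x| * `|y|;
  cnorm_star : forall x : A, `|cmul (star x) x| = `|x| ^+ 2
}.

#[short(type="cstarAlgType")]
HB.structure Definition CStarAlgebra (K : numClosedFieldType) :=
  {A of CompleteNormedModule K A & isCStarAlgebra K A}.

(* The complex numbers, under a name whose canonical topology is found by
   unification (that of R[i] is not). *)
Definition Cplx (R : realType) : numClosedFieldType := R[i].

(* C(X) with the supremum norm; compactness of X is a parameter of the type so
   that the instances below, which need it, can be declared on it. *)
Definition ctsC (R : realType) (X : topologicalType)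
  (cX : compact [set: X]) : Type := continuousType X (Cplx R).

Section ctsC.
Context {R : realType} {X : topologicalType} {cX : compact [set: X]}.
Local Notation K := (Cplx R).
Local Notation C := (ctsC R cX).
Implicit Types f g : C.

Definition ctsC_fun (f : C) : X -> K := (f : continuousType X K).
Coercion ctsC_fun : ctsC >-> Funclass.

Lemma ctsC_continuous f : continuous (f : X -> K). Proof. exact: cts_fun. Qed.

Lemma ctsCP f g : (forall x, f x = g x) -> f = g.
Proof. by move=> fg; apply/continuousEP. Qed.

HB.instance Definition _ := Choice.copy C (continuousType X K).

Definition mkctsC (f : X -> K) (cf : continuous f) : C :=
  (mkcts cf : continuousType X K).

Lemma mkctsCE (f : X -> K) (cf : continuous f) x : mkctsC cf x = f x.
Proof. by []. Qed.

Fact ctsC_zero_cts : continuous (fun _ : X => 0 : K).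
Proof. exact: cst_continuous. Qed.
Fact ctsC_opp_cts f : continuous (fun x => - f x : K).
Proof. by move=> x; apply: cvgN; exact: ctsC_continuous. Qed.
Fact ctsC_add_cts f g : continuous (fun x => f x + g x : K).
Proof. by move=> x; apply: cvgD; exact: ctsC_continuous. Qed.
Fact ctsC_scale_cts (c : K) f : continuous (fun x => c * f x : K).
Proof. by move=> x; apply: cvgM; [exact: cvg_cst|exact: ctsC_continuous]. Qed.
Fact ctsC_mul_cts f g : continuous (fun x => f x * g x : K).
Proof. by move=> x; apply: cvgM; exact: ctsC_continuous. Qed.
Fact ctsC_star_cts f : continuous (fun x => (f x)^* : K).
Proof.
move=> x; apply/cvgrPdist_lt => e e0.
have /cvgrPdist_lt/(_ e e0) := @ctsC_continuous f x.
by apply: filterS => t; rewrite -rmorphB norm_conjC.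
Qed.

Definition ctsC_zero : C := mkctsC ctsC_zero_cts.
Definition ctsC_opp f : C := mkctsC (@ctsC_opp_cts f).
Definition ctsC_add f g : C := mkctsC (@ctsC_add_cts f g).
Definition ctsC_scale (c : K) f : C := mkctsC (@ctsC_scale_cts c f).
Definition ctsC_mul f g : C := mkctsC (@ctsC_mul_cts f g).
Definition ctsC_star f : C := mkctsC (@ctsC_star_cts f).

Fact ctsC_addA : associative ctsC_add.
Proof. by move=> f g h; apply: ctsCP => x; exact: addrA. Qed.
Fact ctsC_addC : commutative ctsC_add.
Proof. by move=> f g; apply: ctsCP => x; exact: addrC. Qed.
Fact ctsC_add0 : left_id ctsC_zero ctsC_add.
Proof. by move=> f; apply: ctsCP => x; exact: add0r. Qed.
Fact ctsC_addN : left_inverse ctsC_zero ctsC_opp ctsC_add.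
Proof. by move=> f; apply: ctsCP => x; exact: addNr. Qed.

HB.instance Definition _ :=
  GRing.isZmodule.Build C ctsC_addA ctsC_addC ctsC_add0 ctsC_addN.

Fact ctsC_scaleA (a b : K) f :
  ctsC_scale a (ctsC_scale b f) = ctsC_scale (a * b) f.
Proof. by apply: ctsCP => x; exact: mulrA. Qed.
Fact ctsC_scale1 : left_id 1 ctsC_scale.
Proof. by move=> f; apply: ctsCP => x; exact: mul1r. Qed.
Fact ctsC_scaleDr : right_distributive ctsC_scale +%R.
Proof. by move=> a f g; apply: ctsCP => x; exact: mulrDr. Qed.
Fact ctsC_scaleDl f : {morph ctsC_scale^~ f : a b / a + b}.
Proof. by move=> a b; apply: ctsCP => x; exact: mulrDl. Qed.

HB.instance Definition _ := GRing.Zmodule_isLmodule.Build K C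
  ctsC_scaleA ctsC_scale1 ctsC_scaleDr ctsC_scaleDl.

Definition supnorm (f : C) : R := sup (range (fun x => normc (f x))).
Definition ctsC_norm (f : C) : K := ((supnorm f)%:C)%C.

Lemma normcK (z : K) : `|z| = ((normc z)%:C)%C :> K.
Proof. by []. Qed.

Lemma normc_continuous f : continuous (fun x => normc (f x) : R).
Proof.
move=> x; apply/cvgrPdist_lt => e e0.
have e0' : 0 < (e%:C)%C :> K by rewrite ltcR.
have /cvgrPdist_lt/(_ _ e0') := @ctsC_continuous f x.
apply: filterS => t; rewrite normcK ltcR; apply: le_lt_trans.
have H (a b : K) : normc a - normc b <= normc (a - b).
  by rewrite lerBlDr -{1}(subrK b a); exact: le_normcD.
rewrite ler_norml H andbT lerNl (_ : - _ = normc (f t) - normc (f x)).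
  by rewrite -(normcN (f x - f t)) opprB.
by rewrite opprB.
Qed.

Lemma supnorm_has_ubound f : has_ubound (range (fun x => normc (f x))).
Proof.
have /compact_bounded : compact ((fun x => normc (f x)) @` [set: X]).
  apply: continuous_compact cX.
  by apply: continuous_subspaceT; exact: normc_continuous.
move=> -[M [_ /(_ (M + 1))]]; rewrite ltrDl ltr01 => /(_ isT) bd.
by exists (M + 1) => _ [x _ <-]; apply: le_trans (ler_norm _) (bd _ _); exists x.
Qed.

Lemma supnorm_ge f x : normc (f x) <= supnorm f.
Proof. by apply: ub_le_sup; [exact: supnorm_has_ubound|exists x]. Qed.

Lemma normc_ge0' (z : K) : 0 <= normc z.
Proof. by case: z => a b; exact: sqrtr_ge0. Qed.

Lemma supnorm_le f M : 0 <= M -> (forall x, normc (f x) <= M) -> supnorm f <= M.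
Proof.
move=> M0 fM; rewrite /supnorm; have [->|] :=
  eqVneq (range (fun x => normc (f x))) (set0 : set R).
  by rewrite sup0.
by move/set0P => ne; apply: ge_sup => // _ [x _ <-]; exact: fM.
Qed.

Lemma supnorm_ge0 f : 0 <= supnorm f.
Proof.
rewrite /supnorm; have [->|/set0P ne] :=
  eqVneq (range (fun x => normc (f x))) (set0 : set R); first by rewrite sup0.
case: ne => _ [x _ _]; exact: le_trans (normc_ge0' (f x)) (supnorm_ge f x).
Qed.

Fact ctsC_normD f g : ctsC_norm (f + g) <= ctsC_norm f + ctsC_norm g.
Proof.
rewrite /ctsC_norm -rmorphD lecR; apply: supnorm_le.
  by rewrite addr_ge0 ?supnorm_ge0.
move=> x; apply: le_trans (le_normcD _ _) _.
by rewrite lerD ?supnorm_ge.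
Qed.

Fact ctsC_normZ (c : K) f : ctsC_norm (c *: f) = `|c| * ctsC_norm f.
Proof.
rewrite normcK /ctsC_norm -rmorphM; congr ((_)%:C)%C.
have le (a : K) g : supnorm (a *: g) <= normc a * supnorm g.
  apply: supnorm_le => [|x]; first by rewrite mulr_ge0 ?supnorm_ge0 ?normc_ge0'.
  rewrite -[X in normc X]/(a * g x).
  by rewrite normcM ler_wpM2l ?supnorm_ge ?normc_ge0'.
apply/eqP; rewrite eq_le le /=; have [->|c0] := eqVneq c 0.
  by rewrite normc0 mul0r supnorm_ge0.
rewrite -{1}(scalerK c0 f).
apply: le_trans (ler_wpM2l (normc_ge0' c) (le _ _)) _.
rewrite mulrA -normcM mulfV //.
by rewrite normc1 mul1r.
Qed.

Fact ctsC_norm0 f : ctsC_norm f = 0 -> f = 0.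
Proof.
move=> /eqP; rewrite /ctsC_norm -(rmorph0 (real_complex R)) (inj_eq (@complexI _)).
move=> /eqP f0; apply: ctsCP => x; apply: eq0_normc; apply/eqP.
by rewrite eq_le normc_ge0' -f0 supnorm_ge.
Qed.

HB.instance Definition _ :=
  Lmodule_isNormed.Build K C ctsC_normD ctsC_normZ ctsC_norm0.

Lemma ctsC_normE f : `|f| = ctsC_norm f. Proof. by []. Qed.

Lemma ctsC_norm_ge f x : `|f x| <= `|f|.
Proof. by rewrite ctsC_normE normcK lecR supnorm_ge. Qed.

Lemma ctsC_norm_le f (M : K) : 0 <= M -> (forall x, `|f x| <= M) -> `|f| <= M.
Proof.
move=> M0 fM; have [m mE] : exists m, M = (m%:C)%C.
  by exists (complex.Re M); rewrite RRe_real// ger0_real.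
move: M0 fM; rewrite mE ctsC_normE => m0 fM; rewrite /ctsC_norm lecR.
by apply: supnorm_le => [|x]; rewrite -lecR// -normcK.
Qed.

Fact ctsC_complete (F : set_system C) : ProperFilter F -> cauchy F -> cvg F.
Proof.
move=> FF Fc.
have Fb (e : K) : 0 < e -> exists f : C, F [set g : C | `|f - g| < e].
  move=> e0; have [f] : exists f : C, F (ball f e) by move/cauchyP : Fc; apply.
  by rewrite -ball_normE; exists f.
have cplxL (u : X -> C -> R) : (forall x f g, `|u x f - u x g| <= normc (f x - g x)) ->
   forall x, cvg (u x @ F).
  move=> uL x; apply: cauchy_cvg; apply/cauchyP => e e0.
  have e0' : 0 < (e%:C)%C :> K by rewrite ltcR.
  have [f Ff] := Fb _ e0'.
  exists (u x f); suff : F [set g | `|u x f - u x g| < e] by [].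
  apply: filterS Ff => g.
  move=> fg.
  apply: le_lt_trans (uL x f g) _.
  by rewrite -ltcR -normcK; apply: le_lt_trans (ctsC_norm_ge (f - g) x) fg.
have Hre (z : K) : `|complex.Re z| <= normc z.
  by rewrite -lecR -normcK; exact: normc_ge_Re.
have Him (z : K) : `|complex.Im z| <= normc z.
  case: z => a b /=; rewrite -sqrtr_sqr ler_wsqrtr// lerDr; exact: sqr_ge0.
pose re x (f : C) := complex.Re (f x); pose im x (f : C) := complex.Im (f x).
have cre : forall x, cvg (re x @ F).
  apply: cplxL => x f g; apply: le_trans (Hre _).
  by rewrite /re; case: (f x) (g x) => [a b] [a' b'].
have cim : forall x, cvg (im x @ F).
  apply: cplxL => x f g; apply: le_trans (Him _).
  by rewrite /im; case: (f x) (g x) => [a b] [a' b'].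
pose l (x : X) : K := Complex (lim (re x @ F)) (lim (im x @ F)).
have unif (e : K) : 0 < e -> F [set f : C | forall x, `|l x - f x| <= e].
  move=> e0; have e20 : 0 < e / 2 by rewrite divr_gt0.
  have [f0 Ff0] := Fb _ e20.
  near=> f => /= x.
  apply/ler_addgt0Pr => d d0.
  have dE : d = ((complex.Re d)%:C)%C by rewrite RRe_real// gtr0_real.
  set dr := complex.Re d in dE.
  have dr0 : 0 < dr by move: d0; rewrite dE ltcR.
  have dr20 : 0 < dr / 2 by rewrite divr_gt0.
  near F => g.
  have fg : `|f x - g x| <= e.
    have -> : f x - g x = (f0 x - g x) - (f0 x - f x) by rewrite opprB [RHS]addrC addrA subrK.
    apply: le_trans (ler_normB _ _) _; rewrite [e]splitr lerD //.
      apply: le_trans (ctsC_norm_ge (f0 - g) x) (ltW _).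
      by near: g.
    apply: le_trans (ctsC_norm_ge (f0 - f) x) (ltW _).
    by near: f.
  have lg : `|l x - g x| <= d.
    rewrite normcK dE lecR.
    have h1 : `|lim (re x @ F) - re x g| < dr / 2.
      by near: g; move/cvgrPdist_lt : (cre x); apply.
    have h2 : `|lim (im x @ F) - im x g| < dr / 2.
      by near: g; move/cvgrPdist_lt : (cim x); apply.
    have -> : l x - g x = (((lim (re x @ F) - re x g)%:C)%C : K)
       + Complex 0 (lim (im x @ F) - im x g).
      rewrite /l /re /im; case: (g x) => a b; congr Complex; by rewrite ?addr0 ?add0r.
    apply: le_trans (le_normcD _ _) _.
    rewrite /= !expr0n /= addr0 add0r !sqrtr_sqr [leRHS]splitr.
    by rewrite lerD // ltW.
  have -> : l x - f x = (l x - g x) - (f x - g x) by rewrite opprB addrA subrK.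
  by apply: le_trans (ler_normB _ _) _; rewrite addrC lerD.
have lc : continuous l.
  move=> x; apply/cvgrPdist_le => e e0.
  have e30 : 0 < e / 3 by rewrite divr_gt0.
  have [f Hf] := filter_ex (unif _ e30).
  have /cvgrPdist_le/(_ _ e30) := @ctsC_continuous f x.
  apply: filterS => t ft.
  have -> : l x - l t = (l x - f x) + (f x - f t) + (f t - l t).
    by rewrite !subrKA.
  have -> : e = e / 3 + e / 3 + e / 3.
    have n3 : 3 != 0 :> K by rewrite pnatr_eq0.
    by rewrite -[LHS](divfK n3) mulr_natr 2!mulrS mulr1n addrA.
  apply: le_trans (ler_normD _ _) _; apply: lerD; last by rewrite distrC.
  by apply: le_trans (ler_normD _ _) _; apply: lerD.
apply/cvg_ex; exists (mkctsC lc); apply/cvgrPdist_le => e e0.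
have := unif _ e0; apply: filterS => f Hf.
by apply: ctsC_norm_le => [|x]; [exact: ltW | exact: Hf].
Unshelve. all: by end_near. Qed.

HB.instance Definition _ := Uniform_isComplete.Build C ctsC_complete.

Fact ctsC_mulA : associative ctsC_mul.
Proof. by move=> f g h; apply: ctsCP => x; exact: mulrA. Qed.
Fact ctsC_mulDl : left_distributive ctsC_mul +%R.
Proof. by move=> f g h; apply: ctsCP => x; exact: mulrDl. Qed.
Fact ctsC_mulDr : right_distributive ctsC_mul +%R.
Proof. by move=> f g h; apply: ctsCP => x; exact: mulrDr. Qed.
Fact ctsC_mulZl (c : K) f g : ctsC_mul (c *: f) g = c *: ctsC_mul f g.
Proof. by apply: ctsCP => x; exact/esym/mulrA. Qed.
Fact ctsC_mulZr (c : K) f g : ctsC_mul f (c *: g) = c *: ctsC_mul f g.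
Proof. by apply: ctsCP => x; exact: mulrCA. Qed.
Fact ctsC_starK : involutive ctsC_star.
Proof. by move=> f; apply: ctsCP => x; exact: conjCK. Qed.
Fact ctsC_starD : {morph ctsC_star : f g / f + g}.
Proof. by move=> f g; apply: ctsCP => x; exact: rmorphD. Qed.
Fact ctsC_starZ (c : K) f : ctsC_star (c *: f) = c^* *: ctsC_star f.
Proof. by apply: ctsCP => x; exact: rmorphM. Qed.
Fact ctsC_starM : {morph ctsC_star : f g / ctsC_mul f g >-> ctsC_mul g f}.
Proof. by move=> f g; apply: ctsCP => x; exact: etrans (rmorphM _ _ _) (mulrC _ _). Qed.
Fact ctsC_normM f g : `|ctsC_mul f g| <= `|f| * `|g|.
Proof.
apply: ctsC_norm_le => [|x]; first by rewrite mulr_ge0.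
by rewrite mkctsCE normrM ler_pM ?ctsC_norm_ge.
Qed.
Fact ctsC_norm_star f : `|ctsC_mul (ctsC_star f) f| = `|f| ^+ 2.
Proof.
apply/eqP; rewrite eq_le; apply/andP; split.
  apply: ctsC_norm_le => [|x]; first by rewrite exprn_ge0.
  by rewrite !mkctsCE normrM norm_conjC -expr2 lerXn2r ?nnegrE ?ctsC_norm_ge.
rewrite -[leRHS]sqrtCK lerXn2r ?nnegrE ?sqrtC_ge0 //.
apply: ctsC_norm_le => [|x]; first by rewrite sqrtC_ge0.
rewrite -[leLHS]sqrCK // ler_sqrtC ?nnegrE ?exprn_ge0 //.
have := ctsC_norm_ge (ctsC_mul (ctsC_star f) f) x.
by rewrite !mkctsCE normrM norm_conjC -expr2.
Qed.

HB.instance Definition _ := isCStarAlgebra.Build K C ctsC_mulA ctsC_mulDl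
  ctsC_mulDr ctsC_mulZl ctsC_mulZr ctsC_starK ctsC_starD ctsC_starZ ctsC_starM
  ctsC_normM ctsC_norm_star.

End ctsC.

(* Some n is the finite ordinal n, and None is the ordinal omega. *)
Definition omega1 : Type := option nat.

HB.instance Definition _ := Choice.copy omega1 (option nat).

Definition omega1_le (x y : omega1) : bool :=
  match x, y with
  | _, None => true
  | None, Some _ => false
  | Some m, Some n => (m <= n)%N
  end.

Fact omega1_le_refl : reflexive omega1_le.
Proof. by case=> //= n; exact: leqnn. Qed.
Fact omega1_le_anti : antisymmetric omega1_le.
Proof. by case=> [m|] [n|] //= /anti_leq ->. Qed.
Fact omega1_le_trans : transitive omega1_le.
Proof. by case=> [m|] [n|] [p|] //=; exact: leq_trans. Qed.

Fact omega1_display : Order.disp_t. Proof. exact: Order.Disp tt tt. Qed.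

HB.instance Definition _ := Order.Le_isPOrder.Build omega1_display omega1
  omega1_le_refl omega1_le_anti omega1_le_trans.

Fact omega1_le_total : total (<=%O : rel omega1).
Proof. by case=> [m|] [n|] //=; exact: leq_total. Qed.

HB.instance Definition _ :=
  Order.POrder_isTotal.Build omega1_display omega1 omega1_le_total.

Definition omega1_top : topologicalType := order_topology omega1.

Lemma omega1_compact : compact [set: omega1_top].
Proof.
move=> F FF _; apply: contrapT => Fn.
have : ~ cluster F (None : omega1_top) by move=> cF; apply: Fn; exists None.
move=> /existsNP[A] /existsNP[B] /not_implyP[FA] /not_implyP[+ AB].
rewrite itv_nbhsE => -[i [io iN] iB].
have [n nB] : exists n, forall m, (n < m)%N -> B (Some m : omega1_top).
  case: i io iN iB => -[bl l|[]] [br r|[]] //= io iN iB.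
  - by case: br r io iN {iB} => [] [r|]; case: bl l => [] [l|].
  - by case: bl l io iN {iB} => [] [l|].
  - case: bl l io iN iB => [] [l|] // _ _ iB.
    exists l => m lm; apply: iB; rewrite /= in_itv /= andbT.
    suff : ((Some l : omega1) < Some m)%O by [].
    rewrite lt_neqAle; apply/andP; split; last exact: ltnW.
    by apply/eqP => -[lm']; rewrite lm' ltnn in lm.
  - by case: br r io iN {iB} => [] [r|].
  - by exists 0%N => m _; apply: iB; rewrite /= in_itv.
pose S : set omega1_top := [set Some m | m in `I_n.+1].
have /finite_compact cS : finite_set S by apply: finite_image; exact: finite_II.
have FS : F S.
  apply: filterS FA => -[m|] Am; last first.
    by exfalso; apply: AB; exists None; split=> //; apply: iB.
  exists m => //=; rewrite ltnS leqNgt; apply/negP => nm.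
  by apply: AB; exists (Some m); split => //; exact: nB.
by have [x [_ cx]] := cS F FF FS; apply: Fn; exists x.
Qed.

Definition C_omega1 (R : realType) : cstarAlgType (Cplx R) :=
  ctsC R omega1_compact.

Section cstar_presentations.
Context {K : numClosedFieldType}.

Definition star_subalgebra (A : cstarAlgType K) (B : set A) : Prop :=
  [/\ B 0, forall x y, B x -> B y -> B (x + y),
      forall (c : K) x, B x -> B (c *: x),
      forall x y, B x -> B y -> B (cmul x y) &
      forall x, B x -> B (star x)].

Record cstar_presentation (A : cstarAlgType K) := CStarPresentation {
  special : nat -> A;
  special_dense : dense (smallest (@star_subalgebra A) (range special)) }.

(* The pair (a, b) represents the rational number a / (b + 1). *)
Notation fraction := (int * nat)%type.
Definition fraction_val (q : fraction) : K := q.1%:~R / q.2.+1%:R.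

(* A noncommutative *-polynomial over Q(i) without constant term is a list of
   monomials: a coefficient a + ib and a nonempty word, in which (i, false)
   stands for the i-th indeterminate and (i, true) for its adjoint. *)
Notation starpoly :=
  (seq ((fraction * fraction) * ((nat * bool) * seq (nat * bool))))%type.

Definition letter_val (A : cstarAlgType K) (P : cstar_presentation A)
    (l : nat * bool) : A :=
  if l.2 then star (special P l.1) else special P l.1.

Definition word_val (A : cstarAlgType K) (P : cstar_presentation A)
    (w : (nat * bool) * seq (nat * bool)) : A :=
  foldl (fun x l => cmul x (letter_val P l)) (letter_val P w.1) w.2.

(* A generated point is given to programs as a *-polynomial p naming it. *)
Definition gen_point (A : cstarAlgType K) (P : cstar_presentation A)
    (p : starpoly) : A :=
  \sum_(t <- p) (fraction_val t.1.1 + 'i * fraction_val t.1.2) *: word_val P t.2.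

Definition computable_presentation (A : cstarAlgType K)
    (P : cstar_presentation A) : Prop :=
  exists f : starpoly * nat -> fraction, computable f /\
    forall p k, `|fraction_val (f (p, k)) - `|gen_point P p| | < 2 ^- k.

Definition star_isomorphism (A B : cstarAlgType K) (phi : A -> B) : Prop :=
  [/\ bijective phi, linear phi,
      {morph phi : x y / cmul x y} & {morph phi : x / star x}].

Definition computable_map (A B : cstarAlgType K) (P : cstar_presentation A)
    (Q : cstar_presentation B) (phi : A -> B) : Prop :=
  exists f : starpoly * nat -> starpoly, computable f /\
    forall p k, `|gen_point Q (f (p, k)) - phi (gen_point P p)| < 2 ^- k.

Definition computably_star_isomorphic (A B : cstarAlgType K)
    (P : cstar_presentation A) (Q : cstar_presentation B) : Prop :=
  exists phi : A -> B, star_isomorphism phi /\ computable_map P Q phi.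

End cstar_presentations.

(* The letter (i, false) is x_i and (i, true) is its inverse. *)
Definition linv (a : nat * bool) : nat * bool := (a.1, ~~ a.2).

Definition freely_reduced (w : seq (nat * bool)) : bool :=
  sorted (fun a b => b != linv a) w.

Record free_group := FreeWord {
  free_word :> seq (nat * bool);
  free_wordP : freely_reduced free_word }.

HB.instance Definition _ := [isSub for free_word].
HB.instance Definition _ := [Countable of free_group by <:].

#[global] Instance coded_free_group : coded free_group :=
  Coded (inj_comp code_inj (@val_inj _ _ free_group)).

Definition fpush (a : nat * bool) (w : seq (nat * bool)) : seq (nat * bool) :=
  if w is b :: w' then if b == linv a then w' else a :: w else [:: a].

Definition fmulw (v w : seq (nat * bool)) := foldr fpush w v.
Definition finvw (w : seq (nat * bool)) := rev (map linv w).

Lemma linvK : involutive linv. Proof. by case=> i b; rewrite /linv /= negbK. Qed.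

Lemma fpush_reduced a w : freely_reduced w -> freely_reduced (fpush a w).
Proof.
case: w => //= b w; case: eqP => /= [_|/eqP ab]; first exact: path_sorted.
by rewrite /freely_reduced /= ab.
Qed.

Lemma fmulw_reduced v w : freely_reduced w -> freely_reduced (fmulw v w).
Proof. by move=> rw; elim: v => //= a v; exact: fpush_reduced. Qed.

Lemma fpushK a w : freely_reduced w -> fpush a (fpush (linv a) w) = w.
Proof.
case: w => [|b w] /=; first by rewrite eqxx.
rewrite linvK; case: eqP => [-> |_] /=; last by rewrite eqxx.
by case: w => [|c w] //= /andP[/negPf ->].
Qed.

Lemma fmulw_fpush a v w : freely_reduced w ->
  fmulw (fpush a v) w = fpush a (fmulw v w).
Proof.
move=> rw; case: v => //= b v; case: eqP => //= ->.
by rewrite fpushK // fmulw_reduced.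
Qed.

Lemma fmulwA u v w : freely_reduced w ->
  fmulw u (fmulw v w) = fmulw (fmulw u v) w.
Proof.
by move=> rw; elim: u => //= a u ->; rewrite fmulw_fpush.
Qed.

Lemma fmulw_nil w : freely_reduced w -> fmulw w [::] = w.
Proof.
elim: w => //= a w IH raw.
have rw : freely_reduced w by exact: path_sorted raw.
rewrite IH //; case: w raw {IH rw} => //= b w /andP[/negPf -> _] //.
Qed.

Lemma finvw_reduced w : freely_reduced w -> freely_reduced (finvw w).
Proof.
rewrite /freely_reduced /finvw rev_sorted sorted_map.
apply: sub_sorted => a b /=.
by apply: contraNneq => /(can_inj linvK) ->; rewrite linvK eqxx.
Qed.

Lemma fmulVw w : fmulw (finvw w) w = [::].
Proof.
rewrite /fmulw /finvw; elim: w => //= a w IH.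
by rewrite rev_cons -cats1 foldr_cat /= linvK eqxx.
Qed.

Lemma finvwK : involutive finvw.
Proof. by move=> w; rewrite /finvw map_rev revK mapK //; exact: linvK. Qed.

Definition free_one : free_group := @FreeWord [::] isT.
Definition free_inv (v : free_group) : free_group :=
  FreeWord (finvw_reduced (free_wordP v)).
Definition free_mul (v w : free_group) : free_group :=
  FreeWord (fmulw_reduced v (free_wordP w)).

Fact free_mulA : associative free_mul.
Proof. by move=> u v w; apply: val_inj; exact: fmulwA (free_wordP w). Qed.
Fact free_mul1 : left_id free_one free_mul.
Proof. by move=> v; exact: val_inj. Qed.
Fact free_mulr1 : right_id free_one free_mul.
Proof. by move=> v; apply: val_inj; exact: fmulw_nil (free_wordP v). Qed.
Fact free_mulV : left_inverse free_one free_inv free_mul.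
Proof. by move=> v; apply: val_inj; exact: fmulVw. Qed.
Fact free_mulrV : right_inverse free_one free_inv free_mul.
Proof.
by move=> v; apply: val_inj; rewrite /= -{1}[free_word v]finvwK fmulVw.
Qed.

HB.instance Definition _ :=
  isGroup.Build free_group free_mulA free_mul1 free_mulr1 free_mulV free_mulrV.

Record oabGroup := OAbGroup {
  oab_sort :> zmodType;
  cone : set oab_sort;
  coneD : forall x y, cone x -> cone y -> cone (x + y);
  cone_pointed : cone `&` [set - x | x in cone] = [set 0];
  cone_spans : [set x - y | x in cone & y in cone] = [set: oab_sort] }.

Definition ole (G : oabGroup) (x y : G) : Prop := cone (y - x).

Definition positive_hom (G H : oabGroup) (f : G -> H) : Prop :=
  {morph f : x y / x + y} /\ forall x, cone x -> cone (f x).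

Definition order_unit (G : oabGroup) (u : G) : Prop :=
  cone u /\ forall g : G, exists n : nat,
    [/\ (0 < n)%N, ole (- (u *+ n)) g & ole g (u *+ n)].

Definition Zn_cone (n : nat) : set 'rV[int]_n :=
  [set v | forall j, 0 <= v ord0 j].

Fact Zn_coneD n (x y : 'rV[int]_n) :
  Zn_cone x -> Zn_cone y -> Zn_cone (x + y).
Proof. by move=> x0 y0 j; rewrite mxE addr_ge0. Qed.
Fact Zn_cone_pointed n :
  @Zn_cone n `&` [set - x | x in @Zn_cone n] = [set 0].
Proof.
apply/seteqP; split=> [z [z0 [x x0 xz]]|_ ->]; last first.
  by split=> [j|]; [rewrite mxE|exists 0; rewrite ?oppr0// => j; rewrite mxE].
move: z0; rewrite -xz => Nx0; apply/rowP => j; have := Nx0 j; have := x0 j.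
by rewrite !mxE oppr_ge0 => x1 x2; apply/eqP; rewrite oppr_eq0 eq_le x1 x2.
Qed.
Fact Zn_cone_spans n :
  [set x - y | x in @Zn_cone n & y in @Zn_cone n] = [set: 'rV[int]_n].
Proof.
apply/seteqP; split=> // v _.
exists (\row_j Num.max (v ord0 j) 0); first by move=> j; rewrite mxE le_max lexx orbT.
exists (\row_j Num.max (- v ord0 j) 0); first by move=> j; rewrite mxE le_max lexx orbT.
apply/rowP => j; rewrite !mxE; case: (leP 0 (v ord0 j)) => v0.
  by rewrite max_r ?subr0// oppr_le0.
by rewrite max_l ?opprK ?add0r// oppr_ge0 ltW.
Qed.

Definition Zn (n : nat) : oabGroup :=
  OAbGroup (@Zn_coneD n) (Zn_cone_pointed n) (Zn_cone_spans n).

Definition cocone (X : nat -> oabGroup) (a : forall s, X s -> X s.+1)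
    (G : oabGroup) (b : forall s, X s -> G) : Prop :=
  forall s, positive_hom (b s) /\ forall x, b s.+1 (a s x) = b s x.

(* The universal property, in the category of ordered abelian groups and
   positive homomorphisms. *)
Definition inductive_limit (X : nat -> oabGroup) (a : forall s, X s -> X s.+1)
    (G : oabGroup) (b : forall s, X s -> G) : Prop :=
  cocone a b /\
  forall (H : oabGroup) (c : forall s, X s -> H), cocone a c ->
    exists! h : G -> H, positive_hom h /\ forall s x, h (b s x) = c s x.

Definition dimension_group (G : oabGroup) : Prop :=
  exists (n : nat -> nat) (a : forall s, Zn (n s) -> Zn (n s.+1))
    (b : forall s, Zn (n s) -> G),
    (forall s, positive_hom (a s)) /\ inductive_limit a b.

Record unitalGroup := UnitalGroup {
  unital_group :> oabGroup;
  ounit : unital_group;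
  ounitP : order_unit ounit }.

Record group_presentation (G : unitalGroup) := GroupPresentation {
  gp_map :> free_group -> G;
  gp_morph : forall v w : free_group, gp_map (v * w)%g = gp_map v + gp_map w;
  gp_surj : set_surj setT setT gp_map }.

Definition ce_presentation (G : unitalGroup) (nu : group_presentation G) :=
  computably_enumerable (fun w : free_group => nu w = 0) /\
  computably_enumerable (fun w : free_group => cone (nu w)).

Definition unital_isomorphism (G H : unitalGroup) (phi : G -> H) : Prop :=
  [/\ bijective phi, {morph phi : x y / x + y},
      forall x, cone (phi x) <-> cone x & phi (ounit G) = ounit H].

Definition computably_group_isomorphic (G H : unitalGroup)
    (nu : group_presentation G) (mu : group_presentation H) : Prop :=
  exists phi : G -> H, unital_isomorphism phi /\
    exists f : free_group -> free_group, computable f /\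
      forall w, mu (f w) = phi (nu w).

(* Labeled and unlabeled diagrams have the same type: dlabel is None for an
   unlabeled diagram. *)
Record bratteli := Bratteli {
  vertex :> choiceType;
  level : vertex -> nat;
  edge : vertex -> vertex -> nat;
  dlabel : option (vertex -> nat);
  level_finite : forall n, finite_set [set v | level v = n];
  edge_level : forall u v, (0 < edge u v)%N -> level v = (level u).+1 }.

Record diagram_presentation (D : bratteli) := DiagramPresentation {
  dp_map :> nat -> D;
  dp_surj : set_surj setT setT dp_map }.

Definition computable_diagram_presentation (D : bratteli)
    (nu : diagram_presentation D) : Prop :=
  [/\ computable_pred (fun mn : nat * nat => nu mn.1 = nu mn.2),
      computable (fun n => level (nu n)),
      computable (fun mn : nat * nat => edge (nu mn.1) (nu mn.2)),
      (if dlabel D is Some l then computable (fun n => l (nu n)) else True) &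
      exists c : nat -> nat, computable c /\
        forall n, ([set v : D | level v = n] #= `I_(c n))%card].

Definition computably_presentable (D : bratteli) : Prop :=
  exists nu : diagram_presentation D, computable_diagram_presentation nu.

Fixpoint npaths_length (D : bratteli) (d : nat) (u v : D) : nat :=
  if d is d'.+1 then
    \big[addn/0%N]_(w \in [set w : D | level w = (level u).+1])
      (edge u w * npaths_length d' w v)%N
  else (u == v).

Definition npaths (D : bratteli) (u v : D) : nat :=
  if (level u < level v)%N then npaths_length (level v - level u) u v else 0.

Definition same_labels (D D' : bratteli) (f : D -> D') : Prop :=
  match dlabel D, dlabel D' with
  | None, None => True
  | Some l, Some l' => forall v, l v = l' (f v)
  | _, _ => False
  end.

Definition diagram_isomorphic (D D' : bratteli) : Prop :=
  exists f : D -> D', [/\ bijective f, forall v, level (f v) = level v,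
    forall u v, edge (f u) (f v) = edge u v & same_labels f].

(* D is the telescoping of D' along n; the inclusion of the vertex set of D in
   that of D' is an injection f. *)
Definition telescoping_along (n : nat -> nat) (D D' : bratteli) : Prop :=
  [/\ n 0%N = 0%N, forall k, (n k < n k.+1)%N &
    exists f : D -> D', [/\ injective f,
      forall k, [set f v | v in [set v | level v = k]] =
                [set v' | level v' = n k],
      forall u v, level v = (level u).+1 -> edge u v = npaths (f u) (f v) &
      same_labels f]].

Definition telescoping (D D' : bratteli) : Prop :=
  exists n, telescoping_along n D D'.

Definition computable_telescoping (D D' : bratteli) : Prop :=
  exists n, computable n /\ telescoping_along n D D'.

Definition chain_equivalent (T : bratteli -> bratteli -> Prop)
    (D D' : bratteli) : Prop :=
  exists (m : nat) (Ds : nat -> bratteli), [/\ Ds 0%N = D, Ds m = D' &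
    forall j, (j < m)%N -> [\/ diagram_isomorphic (Ds j) (Ds j.+1),
      T (Ds j) (Ds j.+1) | T (Ds j.+1) (Ds j)]].

Definition diagram_equivalent := chain_equivalent telescoping.
Definition diagram_computably_equivalent :=
  chain_equivalent computable_telescoping.

(* Main.v *)
From Pilot Require Import Defs.
From HB Require Import structures.
From Stdlib Require Arith.Cantor.
From mathcomp Require Import all_boot all_order all_algebra.
From mathcomp Require Import complex.
From mathcomp Require Import all_classical all_reals all_analysis.
From mathcomp Require Import ring zify.
(* Some names of Defs, such as code, are shadowed by the libraries. *)
Import Pilot.Defs.
Set Implicit Arguments.
Unset Strict Implicit.
Unset Printing Implicit Defensive.

(* Let W be an undecidable set enumerated by a computable injective sequence;
   W is obtained by diagonalisation over the programs, whose execution is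
   simulated by a stack machine with a computable step function.

   C(omega + 1) and the dimension group of eventually constant integer
   sequences are presented by the constant 1 and by indicators y_e and z_s,
   where z_s is the indicator of a point q_s, and y_e that of a point p_e or,
   if e is enumerated at stage s, of {p_e, q_s}.  The norm of a polynomial in
   the generators, or the sign of an integer combination of them, depends only
   on the values at finitely many known points, so these presentations are
   computable (resp. c.e.) for W as well as for the empty set.  An isomorphism
   preserves minimal projections (resp. atoms), and y_e is one if and only if e
   is not in W.  If it mapped names computably from the presentation of W to
   that of the empty set, where the minimal projections are generators, then
   the complement of W would be c.e., and W decidable.

   For the diagrams, take a strand starting at each e, cut once e has been
   enumerated.  Telescoping along a sequence of levels at which the strands met
   so far have settled, and dropping those that are cut, yields a telescoping
   of the diagram without cuts.  But computable equivalence preserves the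
   existence of a computable bound, in terms of the level of a vertex, on the
   length of the paths from it if these are not arbitrarily long; for the
   diagram with cuts such a bound would decide W. *)

(** * Computable functions *)

Lemma npair_surj n : exists m k, n = npair m k.
Proof.
by exists (Arith.Cantor.of_nat n).1, (Arith.Cantor.of_nat n).2;
  rewrite /npair -surjective_pairing Arith.Cantor.cancel_to_of.
Qed.

Lemma leq_npairl m n : m <= npair m n.
Proof. by apply/leP; have := Arith.Cantor.to_nat_non_decreasing m n; rewrite /npair; lia. Qed.

Lemma leq_npairr m n : n <= npair m n.
Proof. by apply/leP; have := Arith.Cantor.to_nat_non_decreasing m n; rewrite /npair; lia. Qed.

Lemma peval_PFst_inv x b : peval PFst x b -> exists k, x = npair b k.
Proof. by move=> H; inversion H; subst; eexists; reflexivity. Qed.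

Lemma peval_PSnd_inv x b : peval PSnd x b -> exists k, x = npair k b.
Proof. by move=> H; inversion H; subst; eexists; reflexivity. Qed.

Lemma peval_PRec_inv p q x c : peval (PRec p q) x c ->
  (exists2 a, x = npair a 0 & peval p a c) \/
  (exists a n b, [/\ x = npair a n.+1, peval (PRec p q) (npair a n) b &
     peval q (npair a (npair n b)) c]).
Proof.
move=> H; inversion H; subst; first by left; eexists; first reflexivity.
by right; eexists _, _, _; split; first reflexivity; eassumption.
Qed.

Lemma peval_PMu_inv p a n : peval (PMu p) a n ->
  (forall m, m < n -> exists w, peval p (npair a m) w.+1) /\ peval p (npair a n) 0.
Proof.
by move=> H; inversion H; subst; split=> // m mn; eexists; eauto.
Qed.

(** By induction on the evaluation. If two runs of an unbounded search stopped at different values,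
    the program searched would be both zero and nonzero at the smaller one. *)
Lemma peval_det p n a b : peval p n a -> peval p n b -> a = b.
Proof.
move=> H; elim: H b => {p n a}.
- by move=> n b H; inversion H.
- by move=> n b H; inversion H.
- by move=> m n b /peval_PFst_inv[k /npair_inj[]].
- by move=> m n b /peval_PSnd_inv[k /npair_inj[]].
- by move=> p q n a c _ IHa _ IHc b H; inversion H; congr npair; auto.
- move=> p q n a c _ IHa _ IHc b H; inversion H as [| | | | |? ? ? a' ? Ha| | |]; subst.
  by apply: IHc; rewrite (IHa a').
- move=> p q a b _ IH c /peval_PRec_inv[[a' /npair_inj[<- _]]|]; first exact: IH.
  by case=> [? [? [? [/npair_inj[]]]]].
- move=> p q a n b c _ IH1 _ IH2 d /peval_PRec_inv[[a' /npair_inj[]] //|].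
  by case=> [a' [n' [b' [/npair_inj[<- [<-]] /IH1 <- /IH2]]]].
- move=> p a n w _ IHw _ IH0 b /peval_PMu_inv[Hw H0].
  case: (ltngtP n b) => // lt; first by have [m /IH0] := Hw _ lt.
  by have := IHw _ lt _ H0.
Qed.

Definition unpair (n : nat) : nat * nat := Arith.Cantor.of_nat n.

Lemma npairK n : npair (unpair n).1 (unpair n).2 = n.
Proof. by rewrite /npair -surjective_pairing Arith.Cantor.cancel_to_of. Qed.

Lemma unpairK m n : unpair (npair m n) = (m, n).
Proof. exact: Arith.Cantor.cancel_of_to. Qed.

Section combinators.
Context {X : Type} {cX : coded X}.

Lemma computable_ext (A : Type) (cA : coded A) (f g : X -> A) :
  computable f -> (forall x, f x = g x) -> computable g.
Proof. by move=> [p Hp] fg; exists p => x; rewrite -fg. Qed.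

Lemma computable_recode (A B : Type) (cA : coded A) (cB : coded B)
  (f : X -> A) (g : X -> B) :
  computable f -> (forall x, code (f x) = code (g x)) -> computable g.
Proof. by move=> [p Hp] fg; exists p => x; rewrite -fg. Qed.

Lemma computable_comp (A B : Type) (cA : coded A) (cB : coded B)
  (g : A -> B) (f : X -> A) :
  computable g -> computable f -> computable (fun x => g (f x)).
Proof.
by move=> [p Hp] [q Hq]; exists (PComp p q) => x; exact: EvComp (Hq x) (Hp _).
Qed.

Lemma computable_id : computable (fun x : X => x).
Proof.
exists (PPair PFst PSnd) => x; have [m [k ->]] := npair_surj (code x).
exact: EvPair (EvFst _ _) (EvSnd _ _).
Qed.

Lemma computable_cst (A : Type) (cA : coded A) (a : A) : computable (fun _ : X => a).
Proof.
have H n : exists p, forall x : X, peval p (code x) n.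
  elim: n => [|n [p Hp]]; first by exists PZero => x; exact: EvZero.
  by exists (PComp PSucc p) => x; exact: EvComp (Hp x) (EvSucc _).
by have [p Hp] := H (code a); exists p.
Qed.

Lemma computable_pair (A B : Type) (cA : coded A) (cB : coded B)
  (f : X -> A) (g : X -> B) :
  computable f -> computable g -> computable (fun x => (f x, g x)).
Proof.
by move=> [p Hp] [q Hq]; exists (PPair p q) => x; exact: EvPair (Hp x) (Hq x).
Qed.

Lemma computable_fst (A B : Type) (cA : coded A) (cB : coded B) (f : X -> A * B) :
  computable f -> computable (fun x => (f x).1).
Proof.
by move=> [p Hp]; exists (PComp PFst p) => x; apply: EvComp (Hp x) (EvFst _ _).
Qed.

Lemma computable_snd (A B : Type) (cA : coded A) (cB : coded B) (f : X -> A * B) :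
  computable f -> computable (fun x => (f x).2).
Proof.
by move=> [p Hp]; exists (PComp PSnd p) => x; apply: EvComp (Hp x) (EvSnd _ _).
Qed.

Lemma computable_succ (f : X -> nat) :
  computable f -> computable (fun x => (f x).+1).
Proof.
by move=> [p Hp]; exists (PComp PSucc p) => x; apply: EvComp (Hp x) (EvSucc _).
Qed.

Lemma computable_code (A : Type) (cA : coded A) (f : X -> A) :
  computable f -> computable (fun x => code (f x)).
Proof. by move=> Hf; exact: computable_recode Hf _. Qed.

Lemma computable_unpair (f : X -> nat) :
  computable f -> computable (fun x => unpair (f x)).
Proof. by move=> Hf; apply: computable_recode Hf _ => x; exact/esym/npairK. Qed.

Lemma computable_npair (f g : X -> nat) :
  computable f -> computable g -> computable (fun x => npair (f x) (g x)).
Proof. by move=> Hf Hg; exact: computable_recode (computable_pair Hf Hg) _. Qed.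

Lemma computable_nat_of_bool (b : X -> bool) :
  computable b -> computable (fun x => nat_of_bool (b x)).
Proof. by move=> Hb; exact: computable_recode Hb _. Qed.

(** [PRec] hands parameter, counter and accumulator to its step program, exactly as [iteri] does
    here. The bounded loops below reduce to this. *)
Lemma computable_iteri (B : Type) (cB : coded B) (n : X -> nat)
    (st : X -> nat -> B -> B) (z : X -> B) :
  computable n -> computable (fun y : X * (nat * B) => st y.1 y.2.1 y.2.2) ->
  computable z -> computable (fun x => iteri (n x) (st x) (z x)).
Proof.
move=> [pn Hn] [ps Hs] [pz Hz].
have [pi Hi] := computable_id.
exists (PComp (PRec pz ps) (PPair pi pn)) => x.
apply: EvComp (EvPair (Hi x) (Hn x)) _.
have H k : peval (PRec pz ps) (npair (code x) k) (code (iteri k (st x) (z x))).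
  elim: k => [|k IH] /=; first exact: EvRec0 (Hz x).
  exact: EvRecS IH (Hs (x, (k, _))).
exact: H (n x).
Qed.

End combinators.

Lemma computable_iter (X B : Type) (cX : coded X) (cB : coded B) (n : X -> nat)
    (st : X -> B -> B) (z : X -> B) :
  computable n -> computable (fun y : X * B => st y.1 y.2) ->
  computable z -> computable (fun x => iter (n x) (st x) (z x)).
Proof.
move=> Hn Hs Hz.
have H := @computable_iteri X cX B cB n (fun x _ b => st x b) z Hn _ Hz.
apply: computable_ext (H _) _ => [|x]; last by elim: (n x) => //= k ->.
apply: (computable_comp (f := fun y : X * (nat * B) => (y.1, y.2.2)) Hs).
by apply: computable_pair; do ?[apply: computable_fst|apply: computable_snd];
  exact: computable_id.
Qed.

(** A conditional is a loop run once or not at all: the test, as a number, counts the iterations of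
    the constant step [f x] from [g x]. *)
Lemma computable_if (X B : Type) (cX : coded X) (cB : coded B) (b : X -> bool)
    (f g : X -> B) :
  computable b -> computable f -> computable g ->
  computable (fun x => if b x then f x else g x).
Proof.
move=> Hb Hf Hg.
have H := @computable_iter X B cX cB _ (fun x _ => f x) g
  (computable_nat_of_bool Hb) _ Hg.
apply: computable_ext (H _) _ => [|x]; last by case: (b x).
by apply: (computable_comp (f := fst) Hf); apply: computable_fst; exact: computable_id.
Qed.

(** The predecessor of the code of a nonempty list is the code of the pair of its head and tail. A
    recursion of length 0 or 1 keeps the program for [F], specified only on codes of such pairs,
    from being run on the empty list. *)
Lemma computable_match_seq (X A B : Type) (cX : coded X) (cA : coded A)
    (cB : coded B) (s : X -> seq A) (z : X -> B) (F : X -> A -> seq A -> B) :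
  computable s -> computable z ->
  computable (fun y : X * (A * seq A) => F y.1 y.2.1 y.2.2) ->
  computable (fun x => match s x with [::] => z x | a :: t => F x a t end).
Proof.
move=> Hs [pz Hz] [pF HF].
have [pn Hn] : computable (fun x => nat_of_bool (0 < code (s x))).
  apply: (computable_ext (f := fun x => iter (code (s x)) (fun _ => 1) 0)).
    apply: computable_iter; [exact: computable_code|exact: computable_cst..].
  by move=> x; case: (code (s x)).
have [pp Hp] : computable (fun x => (code (s x)).-1).
  apply: (computable_ext (f := fun x => iteri (code (s x)) (fun i _ => i) 0)).
    apply: computable_iteri; [exact: computable_code| |exact: computable_cst].
    by apply: computable_fst; apply: computable_snd; exact: computable_id.
  by move=> x; case: (code (s x)).
have [pi Hi] := @computable_id X cX.
exists (PComp (PRec pz (PComp (PComp pF (PPair pi pp)) PFst)) (PPair pi pn)) => x.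
apply: EvComp (EvPair (Hi x) (Hn x)) _.
have := Hp x; case: (s x) => [|a t] /= H; first exact: EvRec0 (Hz x).
apply: EvRecS (EvRec0 _ (Hz x)) _.
apply: EvComp (EvFst _ _) _.
by apply: EvComp (EvPair (Hi x) H) _; exact: (HF (x, (a, t))).
Qed.

Lemma computable_cons (X A : Type) (cX : coded X) (cA : coded A) (a : X -> A)
    (s : X -> seq A) :
  computable a -> computable s -> computable (fun x => a x :: s x).
Proof.
move=> Ha Hs.
exact: computable_recode (computable_succ (computable_npair
  (computable_code Ha) (computable_code Hs))) _.
Qed.

(* Redefined whenever further computable operations become available. *)
Ltac computable_hook := fail.

Ltac computable_step :=
  match goal with
  | H : computable ?f |- computable ?f => exact H
  | |- computable fst => exact: computable_fst computable_id
  | |- computable snd => exact: computable_snd computable_id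
  | H : computable ?f |- @computable _ _ _ _ (fun x => ?f (@?g x)) =>
      apply: (computable_comp (g := f) (f := g) H)
  | |- @computable _ _ _ _ (fun x => x) => exact: computable_id
  | |- @computable _ _ _ _ (fun _ => ?c) => exact: computable_cst
  | |- @computable _ _ _ _ (fun x => (@?f x, @?g x)) => apply: computable_pair
  | |- @computable _ _ _ _ (fun x => (@?f x).1) => apply: (computable_fst (f := f))
  | |- @computable _ _ _ _ (fun x => (@?f x).2) => apply: (computable_snd (f := f))
  | |- @computable _ _ _ _ (fun x => (@?f x).+1) => apply: (computable_succ (f := f))
  | |- @computable _ _ _ _ (fun x => nat_of_bool (@?f x)) =>
      apply: (computable_nat_of_bool (b := f))
  | |- @computable _ _ _ _ (fun x => code (@?f x)) => apply: (computable_code (f := f))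
  | |- @computable _ _ _ _ (fun x => npair (@?f x) (@?g x)) =>
      apply: (computable_npair (f := f) (g := g))
  | |- @computable _ _ _ _ (fun x => unpair (@?f x)) =>
      apply: (computable_unpair (f := f))
  | |- @computable _ _ _ _ (fun x => if _ then _ else _) => apply: computable_if
  | |- @computable _ _ _ _ (fun x => @?a x :: @?s x) =>
      apply: (computable_cons (a := a) (s := s))
  | |- @computable _ _ _ _ (fun x => match _ with [::] => _ | _ :: _ => _ end) =>
      apply: computable_match_seq
  | |- @computable _ _ _ _ (fun x => iteri (@?n x) (@?s x) (@?z x)) =>
      apply: (computable_iteri (n := n) (st := s) (z := z))
  | |- @computable _ _ _ _ (fun x => iter (@?n x) (@?s x) (@?z x)) =>
      apply: (computable_iter (n := n) (st := s) (z := z))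
  | |- _ => computable_hook
  end.

Ltac computability := repeat (cbn beta; computable_step).

Lemma computable_predn (X : Type) (cX : coded X) (f : X -> nat) :
  computable f -> computable (fun x => (f x).-1).
Proof.
move=> Hf; apply: (computable_ext (f := fun x => iteri (f x) (fun i _ => i) 0)).
  by computability.
by move=> x; case: (f x).
Qed.

Lemma computable_foldl (X A B : Type) (cX : coded X) (cA : coded A) (cB : coded B)
    (st : X -> B -> A -> B) (z : X -> B) (s : X -> seq A) :
  computable (fun y : X * (B * A) => st y.1 y.2.1 y.2.2) -> computable z ->
  computable s -> computable (fun x => foldl (st x) (z x) (s x)).
Proof.
move=> Hst Hz Hs.
pose step x (u : seq A * B) :=
  match u.1 with [::] => u | a :: t => (t, st x u.2 a) end.
(* The code of a list bounds its length, and further steps on the empty list change nothing. *)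
apply: (computable_ext (f := fun x => (iter (code (s x)) (step x) (s x, z x)).2)).
  rewrite /step; computability.
  by apply: (computable_comp (f := fun y : X * (seq A * B) * (A * seq A) =>
    (y.1.1, (y.1.2.2, y.2.1))) Hst); computability.
move=> x; have : size (s x) <= code (s x).
  elim: (s x) => //= a t IH; rewrite ltnS.
  exact: leq_trans IH (leq_npairr _ _).
elim: (s x) (z x) (code (s x)) => [|a t IH] b n /=.
  by move=> _; have -> : iter n (step x) ([::], b) = ([::], b) by elim: n => //= n ->.
by case: n => // n; rewrite ltnS iterSr => /IH ->.
Qed.

Lemma computable_addn (X : Type) (cX : coded X) (f g : X -> nat) :
  computable f -> computable g -> computable (fun x => f x + g x).
Proof.
move=> Hf Hg; apply: (computable_ext (f := fun x => iter (f x) S (g x))).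
  by computability.
by move=> x; rewrite iter_succn addnC.
Qed.

Lemma computable_muln (X : Type) (cX : coded X) (f g : X -> nat) :
  computable f -> computable g -> computable (fun x => f x * g x).
Proof.
move=> Hf Hg; apply: (computable_ext (f := fun x => iter (f x) (fun m => g x + m) 0)).
  computability; apply: computable_addn; computability.
by move=> x; rewrite iter_addn_0 mulnC.
Qed.

Lemma computable_expn (X : Type) (cX : coded X) (f g : X -> nat) :
  computable f -> computable g -> computable (fun x => f x ^ g x).
Proof.
move=> Hf Hg; apply: (computable_ext (f := fun x => iter (g x) (fun m => f x * m) 1)).
  computability; apply: computable_muln; computability.
by move=> x; rewrite iter_muln_1.
Qed.

Lemma computable_subn (X : Type) (cX : coded X) (f g : X -> nat) :
  computable f -> computable g -> computable (fun x => f x - g x).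
Proof.
move=> Hf Hg; apply: (computable_ext (f := fun x => iter (g x) predn (f x))).
  by computability; apply: computable_predn; computability.
by move=> x; rewrite iter_predn.
Qed.

Lemma computable_eqn0 (X : Type) (cX : coded X) (f : X -> nat) :
  computable f -> computable (fun x => f x == 0).
Proof.
move=> Hf; apply: (computable_ext (f := fun x => iter (f x) (fun _ => false) true)).
  by computability.
by move=> x; case: (f x).
Qed.

Lemma computable_leq (X : Type) (cX : coded X) (f g : X -> nat) :
  computable f -> computable g -> computable (fun x => f x <= g x).
Proof. by move=> Hf Hg; apply: computable_eqn0; exact: computable_subn. Qed.

Lemma computable_andb (X : Type) (cX : coded X) (a b : X -> bool) :
  computable a -> computable b -> computable (fun x => a x && b x).
Proof. by move=> Ha Hb; apply: computable_if => //; exact: computable_cst. Qed.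

Lemma computable_orb (X : Type) (cX : coded X) (a b : X -> bool) :
  computable a -> computable b -> computable (fun x => a x || b x).
Proof. by move=> Ha Hb; apply: computable_if => //; exact: computable_cst. Qed.

Lemma computable_negb (X : Type) (cX : coded X) (a : X -> bool) :
  computable a -> computable (fun x => ~~ a x).
Proof. by move=> Ha; apply: computable_if => //; exact: computable_cst. Qed.

Lemma computable_eqn (X : Type) (cX : coded X) (f g : X -> nat) :
  computable f -> computable g -> computable (fun x => f x == g x).
Proof.
move=> Hf Hg; apply: (computable_ext (f := fun x => (f x <= g x) && (g x <= f x))).
  by apply: computable_andb; exact: computable_leq.
by move=> x; rewrite eqn_leq.
Qed.

Lemma computable_odd (X : Type) (cX : coded X) (f : X -> nat) :
  computable f -> computable (fun x => odd (f x)).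
Proof.
move=> Hf; apply: (computable_ext (f := fun x => iter (f x) negb false)).
  by computability; apply: computable_negb; computability.
by move=> x; elim: (f x) => //= n ->.
Qed.

Lemma computable_half (X : Type) (cX : coded X) (f : X -> nat) :
  computable f -> computable (fun x => (f x)./2).
Proof.
move=> Hf.
apply: (computable_ext (f := fun x => iteri (f x) (fun n m => odd n + m) 0)).
  by computability; apply: computable_addn; computability;
    apply: computable_odd; computability.
by move=> x; elim: (f x) => //= n ->; rewrite uphalf_half.
Qed.

Lemma computable_double (X : Type) (cX : coded X) (f : X -> nat) :
  computable f -> computable (fun x => (f x).*2).
Proof.
by move=> Hf; apply: computable_ext (computable_addn Hf Hf) _ => x; rewrite addnn.
Qed.

Ltac computable_arith_step :=
  match goal with
  | |- @computable _ _ _ _ (fun x => (@?f x).-1) => apply: (computable_predn (f := f))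
  | |- @computable _ _ _ _ (fun x => @?f x + @?g x) =>
      apply: (computable_addn (f := f) (g := g))
  | |- @computable _ _ _ _ (fun x => @?f x * @?g x) =>
      apply: (computable_muln (f := f) (g := g))
  | |- @computable _ _ _ _ (fun x => @?f x ^ @?g x) =>
      apply: (computable_expn (f := f) (g := g))
  | |- @computable _ _ _ _ (fun x => @?f x - @?g x) =>
      apply: (computable_subn (f := f) (g := g))
  | |- @computable _ _ _ _ (fun x => @?f x <= @?g x) =>
      apply: (computable_leq (f := f) (g := g))
  | |- @computable _ _ _ _ (fun x => @eq_op _ (@?f x) (@?g x)) =>
      apply: (computable_eqn (f := f) (g := g))
  | |- @computable _ _ _ _ (fun x => @?f x && @?g x) =>
      apply: (computable_andb (a := f) (b := g))
  | |- @computable _ _ _ _ (fun x => @?f x || @?g x) =>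
      apply: (computable_orb (a := f) (b := g))
  | |- @computable _ _ _ _ (fun x => ~~ @?f x) => apply: (computable_negb (a := f))
  | |- @computable _ _ _ _ (fun x => odd (@?f x)) => apply: (computable_odd (f := f))
  | |- @computable _ _ _ _ (fun x => (@?f x)./2) => apply: (computable_half (f := f))
  | |- @computable _ _ _ _ (fun x => (@?f x).*2) => apply: (computable_double (f := f))
  end.
Ltac computable_hook ::= computable_arith_step.

(** * Bounded and unbounded search *)

Section bounded.
Context {X : Type} {cX : coded X}.

Lemma computable_has_iota (P : X -> nat -> bool) (n : X -> nat) :
  computable (fun y : X * nat => P y.1 y.2) -> computable n ->
  computable (fun x => has (P x) (iota 0 (n x))).
Proof.
move=> HP Hn.
apply: (computable_ext (f := fun x => iteri (n x) (fun i b => b || P x i) false)).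
  computability.
  by apply: (computable_comp (f := fun y : X * (nat * bool) => (y.1, y.2.1)) HP);
    computability.
move=> x; elim: (n x) => // k IH.
by rewrite -addn1 iotaD has_cat /= orbF -IH addn1.
Qed.

Lemma computable_all_iota (P : X -> nat -> bool) (n : X -> nat) :
  computable (fun y : X * nat => P y.1 y.2) -> computable n ->
  computable (fun x => all (P x) (iota 0 (n x))).
Proof.
move=> HP Hn; apply: (computable_ext
    (f := fun x => ~~ has (fun i => ~~ P x i) (iota 0 (n x)))).
  by apply: computable_negb; apply: computable_has_iota => //; exact: computable_negb.
by move=> x; rewrite -all_predC; apply: eq_all => i /=; rewrite negbK.
Qed.

Lemma computable_bigmax (F : X -> nat -> nat) (n : X -> nat) :
  computable (fun y : X * nat => F y.1 y.2) -> computable n ->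
  computable (fun x => \max_(i < n x) F x i).
Proof.
move=> HF Hn; apply: (computable_ext (f := fun x =>
    iteri (n x) (fun i m => if m <= F x i then F x i else m) 0)).
  by computability;
  apply: (computable_comp (f := fun y : X * (nat * nat) => (y.1, y.2.1)) HF);
    computability.
move=> x; elim: (n x) => [|k IH] /=; first by rewrite big_ord0.
by rewrite big_ord_recr /= -IH /maxn; case: ltngtP.
Qed.

(** The function is the least witness, found by [PMu], which looks for a zero and hence is applied
    to the negation of [P]. *)
Lemma computable_mu (P : X -> nat -> bool) :
  computable (fun y : X * nat => P y.1 y.2) -> (forall x, exists n, P x n) ->
  exists m : X -> nat, computable m /\ forall x, P x (m x).
Proof.
move=> HP ex; exists (fun x => ex_minn (ex x)); split; last first.
  by move=> x; case: ex_minnP.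
have [p Hp] := computable_nat_of_bool (computable_negb HP).
exists (PMu p) => x; apply: (@EvMu _ _ _ (fun=> 0)) => [m|].
  case: ex_minnP => n Pn minn ltmn; have := Hp (x, m).
  by rewrite /= (contraFF (minn m)) // leqNgt ltmn.
by case: ex_minnP => n Pn _; have := Hp (x, n); rewrite /= Pn.
Qed.

(** An unbounded search whose test ignores the counter stops at 0 if the test is zero and diverges
    otherwise. *)
Lemma computable_pred_ce (S : X -> Prop) : computable_pred S -> computably_enumerable S.
Proof.
move=> HS; have [p Hp] : computable (fun x => nat_of_bool (~~ `[< S x >])).
  by rewrite /computable_pred in HS; computability.
exists (PMu (PComp p PFst)) => x; split=> [Sx|[y /peval_PMu_inv[_ H]]].
  exists 0; apply: (@EvMu _ _ _ (fun=> 0)) => //.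
  by apply: EvComp (EvFst _ _) _; have := Hp x; rewrite asboolT.
apply: contrapT => NSx; have := Hp x; rewrite asboolF //= => Hp1.
by have := peval_det H (EvComp (EvFst _ _) Hp1).
Qed.

End bounded.

Ltac computable_bounded_step :=
  match goal with
  | |- @computable _ _ _ _ (fun x => has (@?P x) (iota 0 (@?n x))) =>
      apply: (computable_has_iota (P := P) (n := n))
  | |- @computable _ _ _ _ (fun x => all (@?P x) (iota 0 (@?n x))) =>
      apply: (computable_all_iota (P := P) (n := n))
  | |- _ => computable_arith_step
  end.
Ltac computable_hook ::= computable_bounded_step.

(** Integers are computed with through their positive and negative parts, so that arithmetic on
    natural numbers suffices. *)
Definition int_pos (z : int) : nat := if z is Posz n then n else 0.
Definition int_neg (z : int) : nat := if z is Negz n then n.+1 else 0.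

Lemma int_posneg (z : int) : z = ((int_pos z)%:Z - (int_neg z)%:Z)%R.
Proof. by case: z => n /=; rewrite ?GRing.subr0 ?GRing.sub0r ?NegzE. Qed.

Section integers.
Context {X : Type} {cX : coded X}.

Lemma computable_int_pos (f : X -> int) :
  computable f -> computable (fun x => int_pos (f x)).
Proof.
move=> Hf; apply: (computable_ext
  (f := fun x => if odd (code (f x)) then 0 else (code (f x))./2)).
  by computability.
by move=> x; case: (f x) => n /=; rewrite odd_double // doubleK.
Qed.

Lemma computable_int_neg (f : X -> int) :
  computable f -> computable (fun x => int_neg (f x)).
Proof.
move=> Hf; apply: (computable_ext
  (f := fun x => if odd (code (f x)) then (code (f x))./2.+1 else 0)).
  by computability.
by move=> x; case: (f x) => n /=; rewrite odd_double //= uphalf_double.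
Qed.

Lemma computable_Posz (f : X -> nat) :
  computable f -> computable (fun x => Posz (f x)).
Proof. by move=> Hf; exact: computable_recode (computable_double Hf) _. Qed.

End integers.

Ltac computable_hook ::=
  match goal with
  | |- @computable _ _ _ _ (fun x => int_pos (@?f x)) =>
      apply: (computable_int_pos (f := f))
  | |- @computable _ _ _ _ (fun x => int_neg (@?f x)) =>
      apply: (computable_int_neg (f := f))
  | |- @computable _ _ _ _ (fun x => Posz (@?f x)) => apply: (computable_Posz (f := f))
  | |- _ => computable_bounded_step
  end.

(** * An undecidable enumerable set *)

Fixpoint prog_code (p : prog) : nat :=
  match p with
  | PZero => npair 0 0
  | PSucc => npair 1 0
  | PFst => npair 2 0
  | PSnd => npair 3 0
  | PPair p q => npair 4 (npair (prog_code p) (prog_code q))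
  | PComp p q => npair 5 (npair (prog_code p) (prog_code q))
  | PRec p q => npair 6 (npair (prog_code p) (prog_code q))
  | PMu p => npair 7 (prog_code p)
  end.

(* A frame (t, (c, (a, b))) is a pending task, applied to the value just
   computed: run the program c (t = 0), run the second component c of a pair
   on a (1), pair up with a first component c (2), make a step of the recursion
   with step program c, parameter a and counter b (3), or test the value of c
   at (a, b) in an unbounded search (4). *)
Notation frame := (nat * (nat * (nat * nat)))%type.
Notation config := (seq frame * nat)%type.

Definition run_frame (c : nat) : frame := (0, (c, (0, 0))).

Definition machine_run (c : nat) (k : seq frame) (v : nat) : config :=
  if (unpair c).1 == 0 then (k, 0)
  else if (unpair c).1 == 1 then (k, v.+1)
  else if (unpair c).1 == 2 then (k, (unpair v).1)
  else if (unpair c).1 == 3 then (k, (unpair v).2)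
  else if (unpair c).1 == 4 then
    (run_frame (unpair (unpair c).2).1 ::
     (1, ((unpair (unpair c).2).2, (v, 0))) :: k, v)
  else if (unpair c).1 == 5 then
    (run_frame (unpair (unpair c).2).2 :: run_frame (unpair (unpair c).2).1 :: k, v)
  else if (unpair c).1 == 6 then
    if (unpair v).2 == 0 then (run_frame (unpair (unpair c).2).1 :: k, (unpair v).1)
    else (run_frame c :: (3, ((unpair (unpair c).2).2, ((unpair v).1, (unpair v).2.-1)))
            :: k, npair (unpair v).1 (unpair v).2.-1)
  else (run_frame (unpair c).2 :: (4, ((unpair c).2, (v, 0))) :: k, npair v 0).

Definition machine_return (f : frame) (k : seq frame) (v : nat) : config :=
  if f.1 == 1 then (run_frame f.2.1 :: (2, (v, (0, 0))) :: k, f.2.2.1)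
  else if f.1 == 2 then (k, npair f.2.1 v)
  else if f.1 == 3 then (run_frame f.2.1 :: k, npair f.2.2.1 (npair f.2.2.2 v))
  else if v == 0 then (k, f.2.2.2)
  else (run_frame f.2.1 :: (4, (f.2.1, (f.2.2.1, f.2.2.2.+1))) :: k,
        npair f.2.2.1 f.2.2.2.+1).

Definition machine_step (s : config) : config :=
  match s.1 with
  | [::] => s
  | f :: k => if f.1 == 0 then machine_run f.2.1 k s.2 else machine_return f k s.2
  end.

Lemma computable_machine_step : computable machine_step.
Proof.
apply: (computable_ext (f := fun s => machine_step s)) => //.
rewrite /machine_step /machine_return /machine_run /run_frame.
by computability.
Qed.

Definition machine_reaches (s s' : config) := exists n, iter n machine_step s = s'.

Lemma machine_reaches_trans s s' s'' :
  machine_reaches s s' -> machine_reaches s' s'' -> machine_reaches s s''.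
Proof. by move=> [m <-] [n <-]; exists (n + m); rewrite iterD. Qed.

Lemma machine_reachesS s s' :
  machine_reaches (machine_step s) s' -> machine_reaches s s'.
Proof. by move=> [n <-]; exists n.+1; rewrite iterSr. Qed.

Lemma machine_reaches_refl s : machine_reaches s s.
Proof. by exists 0. Qed.

(** The stack [k] is arbitrary because subprograms run on top of the frames that wait for their
    values. *)
Lemma machine_simulates p x y : peval p x y -> forall k,
  machine_reaches (run_frame (prog_code p) :: k, x) (k, y).
Proof.
elim=> {p x y}.
- by move=> n k; apply: machine_reachesS; rewrite /machine_step /= /machine_run unpairK;
    exact: machine_reaches_refl.
- by move=> n k; apply: machine_reachesS; rewrite /machine_step /= /machine_run unpairK;
    exact: machine_reaches_refl.
- by move=> m n k; apply: machine_reachesS; rewrite /machine_step /= /machine_run !unpairK;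
    exact: machine_reaches_refl.
- by move=> m n k; apply: machine_reachesS; rewrite /machine_step /= /machine_run !unpairK;
    exact: machine_reaches_refl.
- move=> p q n a b _ IHp _ IHq k.
  apply: machine_reachesS; rewrite /machine_step /= /machine_run !unpairK /=.
  apply: machine_reaches_trans (IHp _) _; apply: machine_reachesS; rewrite /machine_step /=.
  by apply: machine_reaches_trans (IHq _) _; apply: machine_reachesS;
        exact: machine_reaches_refl.
- move=> p q n a b _ IHq _ IHp k.
  apply: machine_reachesS; rewrite /machine_step /= /machine_run !unpairK /=.
  exact: machine_reaches_trans (IHq _) (IHp _).
- move=> p q a b _ IH k.
  apply: machine_reachesS; rewrite /machine_step /= /machine_run !unpairK /=.
  exact: IH.
- move=> p q a n b c _ IHr _ IHq k.
  apply: machine_reachesS; rewrite /machine_step /= /machine_run !unpairK /=.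
  by apply: machine_reaches_trans (IHr _) _; apply: machine_reachesS; exact: IHq.
- move=> p a n w _ IHw _ IH0 k.
  apply: machine_reachesS; rewrite /machine_step /= /machine_run !unpairK /=.
  (* Backward induction from the stopping point: [n - m] is the candidate under test when [m]
     increments remain. *)
  have H m : m <= n -> machine_reaches
    (run_frame (prog_code p) :: (4, (prog_code p, (a, n - m))) :: k, npair a (n - m))
    (k, n).
    elim: m => [_|m IH mn].
      by rewrite subn0; apply: machine_reaches_trans (IH0 _) _; apply: machine_reachesS;
        exact: machine_reaches_refl.
    have lt : n - m.+1 < n by lia.
    apply: machine_reaches_trans (IHw _ lt _) _; apply: machine_reachesS.
    rewrite /machine_step /= /machine_return /=.
    by rewrite -subSn // subSS; apply: IH; exact: ltnW.
  by have := H n (leqnn n); rewrite subnn.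
Qed.

Lemma machine_halted n v : iter n machine_step ([::], v) = ([::], v).
Proof. by elim: n => //= n ->. Qed.

Lemma machine_halted_unique s v w :
  machine_reaches s ([::], v) -> machine_reaches s ([::], w) -> v = w.
Proof.
move=> [m Hm] [n Hn].
have Hv : iter (n + m) machine_step s = ([::], v) by rewrite iterD Hm machine_halted.
have Hw : iter (n + m) machine_step s = ([::], w).
  by rewrite addnC iterD Hn machine_halted.
by move: Hw; rewrite Hv => -[].
Qed.

(** The program coded by [e] is run on [e] itself; the value 0 is the code of [false]. *)
Definition halts_within (e t : nat) : bool :=
  if (iter t machine_step ([:: run_frame e], e)).1 is _ :: _ then false
  else (iter t machine_step ([:: run_frame e], e)).2 == 0.

Lemma computable_halts_within : computable (fun x : nat * nat => halts_within x.1 x.2).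
Proof.
have := computable_machine_step; rewrite /halts_within /run_frame => H.
by computability.
Qed.

Lemma halts_withinS e t : halts_within e t -> halts_within e t.+1.
Proof. by rewrite /halts_within /=; case: (iter t _ _) => [[]]. Qed.

Lemma halts_within_mono e s t : s <= t -> halts_within e s -> halts_within e t.
Proof.
by move=> /subnKC <-; elim: (t - s) => [|d IH]; rewrite ?addn0 ?addnS // => /IH/halts_withinS.
Qed.

(* Diagonalisation: a program deciding this set, run on its own code, would
   halt with value 0 exactly if it did not. *)
Lemma halting_undecidable : ~ computable_pred (fun e => exists t, halts_within e t).
Proof.
move=> [p Hp]; have [t Ht] := machine_simulates (Hp (prog_code p)) [::].
have [[s Hs]|N] := pselect (exists t, halts_within (prog_code p) t).
  rewrite asboolT in Ht; last by exists s.
  move: Hs; rewrite /halts_within; case E : (iter s _ _) => [[|//] v] /= /eqP v0.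
  have := machine_halted_unique (ex_intro _ t Ht) (ex_intro _ s E).
  by rewrite v0.
by case: (N); exists t; rewrite /halts_within Ht /= asboolF.
Qed.

(** [en s = e.+1] means that [e] is enumerated at stage [s], and [en s = 0] that nothing is. A stage
    codes a program and a time; only the first halting time counts, whence injectivity. Members are
    doubled so that the odd numbers are never enumerated. *)
Lemma undecidable_enumeration : exists en : nat -> nat,
  [/\ computable en,
      forall s t, 0 < en s -> en s = en t -> s = t,
      forall e s, en s = e.+1 -> ~~ odd e &
      ~ computable_pred (fun e => exists s, en s = e.+1)].
Proof.
pose first e t := ~~ halts_within e t && halts_within e t.+1.
have first_inj e s t : first e s -> first e t -> s = t.
  move=> /andP[s0 s1] /andP[t0 t1]; case: (ltngtP s t) => // lt.
    by case/negP: t0; exact: halts_within_mono s1.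
  by case/negP: s0; exact: halts_within_mono t1.
pose en s := if first (unpair s).1 (unpair s).2 then (unpair s).1.*2.+1 else 0.
exists en; split.
- have H := computable_halts_within; rewrite /en /first; computability.
    by apply: (computable_comp (f := fun x => ((unpair x).1, (unpair x).2)) H); computability.
  by apply: (computable_comp (f := fun x => ((unpair x).1, (unpair x).2.+1)) H); computability.
- move=> s t; rewrite /en; case: ifP => // Fs _; case: ifP => // Ft [/double_inj E].
  by rewrite -(npairK s) -(npairK t) E; congr npair; apply: first_inj Ft; rewrite -E.
- by move=> e s; rewrite /en; case: ifP => // _ [<-]; rewrite odd_double.
- move=> H; apply: halting_undecidable.
  have H2 : computable (fun e => `[< exists s, en s = (e.*2).+1 >]).
    exact: computable_comp H (computable_double computable_id).
  apply: computable_ext H2 _ => e; apply: asbool_equiv_eq; split.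
    move=> [s]; rewrite /en; case: ifP => // /andP[_ Ht] [/double_inj <-].
    by exists (unpair s).2.+1.
  (* Descend to the first halting time; at time 0 the stack is not yet empty. *)
  move=> [t]; elim: t => [|t IH Ht]; first by rewrite /halts_within.
  case Ht0 : (halts_within e t); first exact: IH.
  by exists (npair e t); rewrite /en unpairK /= /first Ht0 Ht.
Qed.

(** * Generators *)

Lemma computable_count (X A : Type) (cX : coded X) (cA : coded A)
    (P : X -> A -> bool) (s : X -> seq A) :
  computable (fun y : X * A => P y.1 y.2) -> computable s ->
  computable (fun x => count (P x) (s x)).
Proof.
move=> HP Hs.
apply: (computable_ext (f := fun x => foldl (fun m a => m + P x a) 0 (s x))).
  apply: computable_foldl => //; computability.
  by apply: (computable_comp (f := fun y : X * (nat * A) => (y.1, y.2.2)) HP);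
    computability.
move=> x; rewrite -[RHS]add0n; elim: (s x) 0 => [|a t IH] m /=; first by rewrite addn0.
by rewrite IH addnA.
Qed.

Lemma computable_all (X A : Type) (cX : coded X) (cA : coded A)
    (P : X -> A -> bool) (s : X -> seq A) :
  computable (fun y : X * A => P y.1 y.2) -> computable s ->
  computable (fun x => all (P x) (s x)).
Proof.
move=> HP Hs.
apply: (computable_ext (f := fun x => count (fun a => ~~ P x a) (s x) == 0)).
  by computability; apply: computable_count => //; computability.
by move=> x; rewrite eqn0Ngt -has_count -all_predC; apply: eq_all => a /=; rewrite negbK.
Qed.

(* The indicator at the point n of the jth generator: the point 0 stands for
   omega and n.+1 for the ordinal n.  Generator 0 is constant and generator j
   is the indicator of {j}, to which {s.*2.+2} is added for j = e.*2.+1 if e is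
   enumerated at stage s. *)
Definition gen_at (en : nat -> nat) (j n : nat) : bool :=
  [|| j == 0, j == n | [&& odd j, 0 < n, ~~ odd n & en n./2.-1 == j./2.+1]].

Lemma computable_gen_at en :
  computable en -> computable (fun x : nat * nat => gen_at en x.1 x.2).
Proof. by move=> H; rewrite /gen_at; computability. Qed.

Lemma gen_at_omega en j : gen_at en j 0 = (j == 0).
Proof. by rewrite /gen_at andbF orbF orbb. Qed.

Lemma gen_at_none j n : gen_at (fun=> 0) j n = (j == 0) || (j == n).
Proof. by rewrite /gen_at /= !andbF orbF. Qed.

Lemma gen_at_even en j n : ~~ odd j -> 0 < j -> gen_at en j n = (n == j).
Proof. by rewrite /gen_at; case: j => // j /negPf -> _; rewrite orbF (eq_sym n). Qed.

Lemma gen_at_odd en j n :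
  odd j -> gen_at en j n = (n == j) || [&& 0 < n, ~~ odd n & en n./2.-1 == j./2.+1].
Proof. by rewrite /gen_at; case: j => // j ->; rewrite (eq_sym n). Qed.

(** The generators below [b] cannot tell a point [n] beyond [b] from omega, unless [n] is the second
    point of some generator [e.*2.+1] below [b]; in that case they cannot tell it from the point
    [e.*2.+1]. *)
Lemma gen_at_bounded en b n : 0 < b ->
  exists2 m, m < b & forall j, j < b -> gen_at en j n = gen_at en j m.
Proof.
move=> b0; have [nb|bn] := ltnP n b; first by exists n.
have [/and4P[n0 on e0 eb]|N] :=
    boolP [&& 0 < n, ~~ odd n, 0 < en n./2.-1 & (en n./2.-1).-1.*2.+1 < b].
  exists (en n./2.-1).-1.*2.+1 => // j jb; rewrite /gen_at n0 on /= odd_double !andbF orbF.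
  rewrite (negPf (_ : j != n)) ?(ltn_eqF (leq_trans jb bn)) //=; congr orb.
  apply/andP/eqP => [[oj /eqP ->]|-> /=].
    by rewrite -{1}(odd_double_half j) oj add1n.
  by rewrite odd_double uphalf_double prednK.
exists 0 => // j jb; rewrite gen_at_omega /gen_at (ltn_eqF (leq_trans jb bn)) /=.
case: eqP => //= j0; apply: contraNF N => /and4P[oj n0 on /eqP E].
by rewrite n0 on E /=; move: (odd_double_half j); rewrite oj add1n => ->.
Qed.

(** It follows that the indicator of each singleton [{n}] is a generator or the difference of two.
    By injectivity of the enumeration, at most one point is added to [{n}]; that point is even, so
    its own generator is the indicator of a singleton. *)
Lemma gen_at_split en n : (forall s t, 0 < en s -> en s = en t -> s = t) -> 0 < n ->
  (forall k, gen_at en n k = (k == n)) \/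
  exists m, [/\ 0 < m, m != n, forall k, gen_at en n k = (k == n) || (k == m) &
    forall k, gen_at en m k = (k == m)].
Proof.
move=> en_inj n0; have [on|en_] := boolP (odd n); last first.
  by left=> k; exact: gen_at_even.
have [[s Es]|N] := pselect (exists s, en s = n./2.+1); [right|left]; last first.
  move=> k; rewrite gen_at_odd //; case: eqP => //= _; apply/negP => /and3P[_ _ /eqP E].
  by apply: N; exists k./2.-1.
exists s.*2.+2; split=> //.
- by apply: contraTneq on => <-; rewrite /= odd_double.
- move=> k; rewrite gen_at_odd //; congr orb; apply/and3P/eqP => [[k0 ok /eqP E]|->].
    rewrite (en_inj s k./2.-1) ?Es ?E //; have := odd_double_half k.
    by rewrite (negPf ok); case: (k./2) => [|h] //=; first by move=> h0; rewrite -h0 in k0.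
  by rewrite /= odd_double doubleK Es.
- by move=> k; apply: gen_at_even; rewrite //= odd_double.
Qed.

Lemma gen_at_odd_enumerated en e s : en s = e.+1 ->
  gen_at en e.*2.+1 e.*2.+1 /\ gen_at en e.*2.+1 s.*2.+2.
Proof.
by move=> E; rewrite !gen_at_odd /= ?odd_double //= eqxx !doubleK uphalf_double E eqxx orbT.
Qed.

Lemma gen_at_not_enumerated en e k : ~ (exists s, en s = e.+1) ->
  gen_at en e.*2.+1 k = (k == e.*2.+1).
Proof.
move=> N; rewrite gen_at_odd /= ?odd_double // uphalf_double; case: eqP => //= _.
by apply/negP => /and3P[_ _ /eqP E]; apply: N; exists k./2.-1.
Qed.

Lemma gen_at_eventually en j : (forall s t, 0 < en s -> en s = en t -> s = t) ->
  exists N, forall n, N <= n -> gen_at en j n = gen_at en j 0.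
Proof.
move=> en_inj; rewrite gen_at_omega; case: (posnP j) => [->|j0]; first by exists 0.
have [H|[m [_ _ H _]]] := gen_at_split en_inj j0.
  by exists j.+1 => n jn; rewrite H gtn_eqF // gtn_eqF.
exists (maxn j m).+1 => n; rewrite gtn_max => /andP[jn mn].
by rewrite H !gtn_eqF.
Qed.

(** The code of a word is thus a computable bound on the generators that occur in it. *)
Lemma code_letter (w : seq (nat * bool)) (l : nat * bool) :
  l \in w -> l.1 < code w.
Proof.
elim: w => //= a w IH; rewrite in_cons ltnS => /orP[/eqP ->|/IH /ltnW H].
  exact: leq_trans (leq_npairl _ _) (leq_npairl _ _).
exact: leq_trans H (leq_npairr _ _).
Qed.

(** * Bratteli diagrams *)

Local Open Scope classical_set_scope.

Lemma fsbig_addn_gt0 (I : choiceType) (A : set I) (F : I -> nat) : finite_set A ->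
  (0 < \big[addn/0%N]_(i \in A) F i)%N <-> exists2 i, A i & (0 < F i)%N.
Proof.
move=> finA; split=> [|[i Ai Fi]]; last by rewrite (fsbigD1 i) //= addn_gt0 Fi.
apply: contraPP => N; rewrite fsbig1 // => i Ai; apply/eqP; rewrite eqn0Ngt.
by apply/negP => Fi; apply: N; exists i.
Qed.

Fixpoint live (D : bratteli) (d : nat) (u : D) : Prop :=
  if d is d'.+1 then exists2 v, 0 < edge u v & live d' v else True.

Fixpoint reach (D : bratteli) (d : nat) (u v : D) : Prop :=
  if d is d'.+1 then exists2 w, 0 < edge u w & reach d' w v else u = v.

Section paths.
Variable D : bratteli.
Implicit Types u v w : D.

Lemma reach_level d u v : reach d u v -> level v = level u + d.
Proof.
elim: d u => [|d IH] u /=; first by move=> ->; rewrite addn0.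
by move=> [w /edge_level lw /IH ->]; rewrite lw addSnnS.
Qed.

Lemma npaths_length_gt0 d u v : 0 < npaths_length d u v <-> reach d u v.
Proof.
elim: d u => [|d IH] u /=; first by rewrite lt0b; split=> /eqP.
rewrite fsbig_addn_gt0; last exact: level_finite.
split=> [[w _]|[w uw /IH wv]]; first by rewrite muln_gt0 => /andP[uw /IH]; exists w.
by exists w; [exact: edge_level uw|rewrite muln_gt0 uw].
Qed.

Lemma live_reach a b u : live (a + b) u <-> exists2 v, reach a u v & live b v.
Proof.
elim: a u => [|a IH] u /=; first by split=> [|[v <-]]; [exists u|].
split=> [[w uw /IH[v wv bv]]|[v [w uw wv] bv]]; first by exists v => //; exists w.
by exists w => //; apply/IH; exists v.
Qed.

Lemma live_leq a b u : a <= b -> live b u -> live a u.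
Proof.
move=> /subnKC <- /live_reach[v uv _]; rewrite -[a]addn0.
by apply/live_reach; exists v.
Qed.

End paths.

(* The number of levels that have to be inspected to be sure that a vertex has
   infinite paths is bounded computably in its level. *)
Definition effectively_live (D : bratteli) : Prop :=
  exists2 b : nat -> nat, computable b &
    forall u : D, live (b (level u)) u -> forall d, live d u.

Section telescoping.
Variables (n : nat -> nat) (D D' : bratteli) (f : D -> D').
Hypothesis n_incr : forall k, n k < n k.+1.
Hypothesis f_level : forall k,
  [set f v | v in [set v | level v = k]] = [set v' | level v' = n k].
Hypothesis f_edge : forall u v,
  level v = (level u).+1 -> edge u v = npaths (f u) (f v).

Lemma level_telescoping u : level (f u) = n (level u).
Proof. by have : [set v' | level v' = n (level u)] (f u) by rewrite -f_level; exists u. Qed.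

Lemma n_mono j k : j <= k -> n j <= n k.
Proof.
move=> /subnKC <-; elim: (k - j) => [|d IH]; first by rewrite addn0.
by rewrite addnS; apply: leq_trans IH (ltnW (n_incr _)).
Qed.

Lemma n_shift j d : n j + d <= n (j + d).
Proof. by elim: d => [|d IH]; rewrite ?addn0 // !addnS (leq_ltn_trans IH). Qed.

(** An edge of [D] from level [k] is a path of [D'] from level [n k] to level [n k.+1]. Conversely,
    a path of [D'] can be split where it meets level [n k.+1], since all vertices there come from
    [D]. *)
Lemma live_telescoping d u :
  live d u <-> live (n (level u + d) - n (level u)) (f u).
Proof.
elim: d u => [|d IH] u; first by rewrite addn0 subnn.
have le1 : n (level u).+1 <= n ((level u).+1 + d) by rewrite n_mono // leq_addr.
have -> : n (level u + d.+1) - n (level u) = (n (level u).+1 - n (level u)) +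
    (n ((level u).+1 + d) - n (level u).+1).
  by rewrite -addSnnS; have := n_incr (level u); lia.
rewrite live_reach /=; split=> [[v uv /IH Lv]|[v' uv' Lv']].
  have lv := edge_level uv; rewrite lv in Lv; exists (f v) => //; apply/npaths_length_gt0.
  by move: uv; rewrite f_edge // /npaths !level_telescoping lv n_incr.
have lv' := reach_level uv'; rewrite level_telescoping subnKC ?(ltnW (n_incr _)) // in lv'.
have [v lv fv] : [set f v | v in [set v | level v = (level u).+1]] v' by rewrite f_level.
exists v; last by apply/IH; rewrite lv fv.
by rewrite f_edge // /npaths !level_telescoping lv n_incr fv; apply/npaths_length_gt0.
Qed.

Lemma effectively_live_telescoping : computable n ->
  effectively_live D <-> effectively_live D'.
Proof.
move=> Hn; split=> -[b Hb bP].
  (* From a vertex at level [k] of [D'], paths first lead to level [n k], which is a level of [D];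
     from there [b k] levels of [D] have to be inspected, that is, up to level [n (k + b k)] of
     [D']. *)
  exists (fun k => n (k + b k)); first by computability.
  move=> u' Lu' d.
  have kn : level u' <= n (level u') by exact: leq_trans (leq_addl _ _) (n_shift 0 _).
  have [w' uw' Lw'] : exists2 w', reach (n (level u') - level u') u' w' &
      live (n (level u' + b (level u')) - n (level u')) w'.
    apply/live_reach; apply: live_leq Lu'.
    by have := n_mono (leq_addr (b (level u')) (level u')); lia.
  have lw' := reach_level uw'; rewrite subnKC // in lw'.
  have [w lw fw] : [set f v | v in [set v | level v = level u']] w' by rewrite f_level.
  rewrite -lw -fw in Lw'; move/live_telescoping/bP: Lw' => Lw.
  apply: (live_leq (leq_addl (n (level u') - level u') d)).
  apply/live_reach; exists w' => //; rewrite -fw.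
  move/live_telescoping: (Lw d); apply: live_leq.
  by have := n_shift (level w) d; lia.
(* A vertex at level [k] of [D] is at level [n k] of [D'], and each edge of [D] stands for at least
   one edge of [D']. *)
exists (fun k => b (n k)); first by computability.
move=> u Lu d; apply/live_telescoping; rewrite -level_telescoping.
apply: bP; rewrite level_telescoping; move/live_telescoping: Lu; apply: live_leq.
by have := n_shift (level u) (b (n (level u))); lia.
Qed.

End telescoping.

Lemma live_isomorphic (D D' : bratteli) (f : D -> D') :
  bijective f -> (forall u v, edge (f u) (f v) = edge u v) ->
  forall d u, live d (f u) <-> live d u.
Proof.
move=> [g fK gK] fE; elim=> [|d IH] u //=; split=> [[v' uv' Lv']|[v uv Lv]].
  by exists (g v'); [rewrite -fE gK|apply/IH; rewrite gK].
by exists (f v); [rewrite fE|apply/IH].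
Qed.

Lemma effectively_live_equivalent (D D' : bratteli) :
  diagram_computably_equivalent D D' -> effectively_live D <-> effectively_live D'.
Proof.
move=> [m [Ds [<- <- Hs]]].
have tele E F : computable_telescoping E F -> effectively_live E <-> effectively_live F.
  move=> [n [Hn [_ incr [f [_ lv ed _]]]]].
  exact: effectively_live_telescoping incr lv ed Hn.
have step j : j < m -> effectively_live (Ds j) <-> effectively_live (Ds j.+1).
  move=> /Hs[[f [bij lv ed _]]|/tele //|/tele[]//]; have L := live_isomorphic bij ed.
  have [g fK gK] := bij; split=> -[b Hb bP]; exists b => // u.
    by rewrite -[u]gK lv => /L/bP H d; apply/L.
  by move=> Lu d; apply/L; apply: bP; rewrite lv; apply/L.
elim: m {Hs} step => // m IH step; rewrite IH; first exact: step.
by move=> j jm; apply: step; exact: ltnW.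
Qed.

(* A diagram whose level k is {0, ..., w k - 1} and in which each vertex has at
   most one outgoing edge, from i at level k to nx k i. *)
Section functional_diagram.
Variables (w : nat -> nat) (nx : nat -> nat -> option nat).
Hypothesis nx_lt : forall k i j, i < w k -> nx k i = Some j -> j < w k.+1.

Definition fvertex : choiceType := {p : nat * nat | p.2 < w p.1}.
Definition flevel (u : fvertex) : nat := (val u).1.
Definition fpos (u : fvertex) : nat := (val u).2.
Definition fedge (u v : fvertex) : nat :=
  (flevel v == (flevel u).+1) && (nx (flevel u) (fpos u) == Some (fpos v)).
Definition fvert k i (ki : i < w k) : fvertex := exist _ (k, i) ki.

Lemma fvertexP (u v : fvertex) : flevel u = flevel v -> fpos u = fpos v -> u = v.
Proof.
by move=> l i; apply: val_inj; case: u v l i => [[a b] ?] [[c d] ?];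
  rewrite /flevel /fpos /= => -> ->.
Qed.

Lemma fpos_lt u : fpos u < w (flevel u). Proof. exact: valP u. Qed.

Lemma card_flevel k : ([set v | flevel v = k] #= `I_(w k))%card.
Proof.
apply/card_set_bijP; exists fpos; split=> [v /= <-|u v|i /= ik].
- exact: fpos_lt.
- by rewrite !inE /= => <- /esym; exact: fvertexP.
- by exists (fvert ik).
Qed.

Lemma flevel_finite k : finite_set [set v | flevel v = k].
Proof. by exists (w k); exact: card_flevel. Qed.

Lemma fedge_level u v : 0 < fedge u v -> flevel v = (flevel u).+1.
Proof. by rewrite lt0b => /andP[/eqP]. Qed.

Definition fdiagram : bratteli := Bratteli None flevel_finite fedge_level.

Fixpoint frun (k d i : nat) : option nat :=
  if d is d'.+1 then (if nx k i is Some j then frun k.+1 d' j else None) else Some i.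

Lemma fedge_vert (u : fdiagram) j (uj : j < w (flevel u).+1) :
  nx (flevel u) (fpos u) = Some j -> fedge u (fvert uj) = 1.
Proof. by rewrite /fedge => ->; rewrite /flevel /fpos /= !eqxx. Qed.

(** At most one path of each length starts at a vertex, so the sum over the next vertices has at
    most one nonzero term. *)
Lemma npaths_length_fdiagram d (u v : fdiagram) : npaths_length d u v =
  (flevel v == flevel u + d) && (frun (flevel u) d (fpos u) == Some (fpos v)).
Proof.
elim: d u => [|d IH] u /=.
  rewrite addn0; congr nat_of_bool; apply/eqP/andP => [-> //|[/eqP l /eqP[E]]].
  exact: fvertexP.
case E : (nx _ _) => [j|]; last first.
  by rewrite fsbig1 ?andbF // => x _; rewrite /fedge E andbF.
have ju := nx_lt (fpos_lt u) E.
rewrite -(@fsbig_widen _ _ _ _ [set (fvert ju : fdiagram)]); last 2 first.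
- by move=> _ ->.
- move=> x [/= lx nex]; rewrite /fedge E; case: eqP => //= lx'; case: eqP => //= -[jx].
  by case: nex; apply: fvertexP.
by rewrite fsbig_set1 fedge_vert // mul1n IH addSnnS.
Qed.

Lemma live_fdiagram d (u : fdiagram) : live d u <-> frun (flevel u) d (fpos u).
Proof.
elim: d u => [|d IH] u //=; case E : (nx _ _) => [j|]; split=> //.
- move=> [v + /IH]; rewrite lt0b /fedge E => /andP[/eqP lv /eqP[->]].
  by rewrite lv.
- move=> L; exists (fvert (nx_lt (fpos_lt u) E)); first by rewrite fedge_vert.
  exact/IH.
- by move=> [v]; rewrite lt0b /fedge E andbF.
Qed.

End functional_diagram.
Arguments fdiagram : clear implicits.
Arguments fpos_lt {w} u.
Arguments fvert {w k i} ki.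

Lemma fdiagram_telescoping (n w w' : nat -> nat) nx nx'
    (nx_lt : forall k i j, i < w k -> nx k i = Some j -> j < w k.+1) :
  n 0 = 0 -> (forall k, n k < n k.+1) -> (forall k, w' k = w (n k)) ->
  (forall k i, i < w' k -> nx' k i = frun nx (n k) (n k.+1 - n k) i) ->
  telescoping (fdiagram w' nx') (fdiagram w nx).
Proof.
move=> n0 n_incr w'E nx'E; exists n; split=> //.
have n_mono j k : j < k -> n j < n k.
  move=> /subnKC <-; elim: (k - _) => [|d IH]; first by rewrite addn0.
  by rewrite addnS; exact: ltn_trans IH (n_incr _).
have le (u : fdiagram w' nx') : fpos u < w (n (flevel u)) by rewrite -w'E fpos_lt.
exists (fun u => fvert (le u)); split=> //.
- move=> u v [/= E1 E2]; apply: fvertexP => //.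
  case: (ltngtP (flevel u) (flevel v)) => // lt; exfalso; move: E1.
    by move/eqP; rewrite (ltn_eqF (n_mono _ _ lt)).
  by move/eqP; rewrite (gtn_eqF (n_mono _ _ lt)).
- move=> k; apply/seteqP; split=> [_ [u /= <- <-]|v /= lv] //.
  have ik : fpos v < w' k by rewrite w'E -lv fpos_lt.
  by exists (fvert ik) => //; apply: fvertexP.
- move=> u v lv; rewrite /npaths npaths_length_fdiagram //=.
  have lv' : flevel v = (flevel u).+1 by [].
  have lE (x : fdiagram w' nx') : flevel (fvert (le x)) = n (flevel x) by [].
  have iE (x : fdiagram w' nx') : fpos (fvert (le x)) = fpos x by [].
  rewrite !lE !iE lv' n_incr subnKC ?(ltnW (n_incr _)) // eqxx /= /fedge lv' eqxx /=.
  by rewrite nx'E // fpos_lt.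
Qed.

(** * The diagrams of strands *)

Definition enumerated_before (en : nat -> nat) (k e : nat) : bool :=
  has (fun s => en s == e.+1) (iota 0 k).

Lemma enumerated_beforeP en k e :
  reflect (exists2 s, s < k & en s = e.+1) (enumerated_before en k e).
Proof.
apply: (iffP hasP) => [[s + /eqP Es]|[s sk Es]]; first by rewrite mem_iota; exists s.
by exists s; [rewrite mem_iota|rewrite Es].
Qed.

Lemma enumerated_before_mono en j k e :
  j <= k -> enumerated_before en j e -> enumerated_before en k e.
Proof.
move=> jk /enumerated_beforeP[s sj Es]; apply/enumerated_beforeP.
by exists s => //; exact: leq_trans sj jk.
Qed.

Definition strand_next en (k i : nat) : option nat :=
  if enumerated_before en k i then None else Some i.

(** Level [k] has the positions below [k]: the strand of [e] starts at level [e.+1], and level 0 is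
    empty. *)
Definition strands en : bratteli := fdiagram id (strand_next en).

Lemma strand_next_lt en k i j : i < id k -> strand_next en k i = Some j -> j < id k.+1.
Proof. by rewrite /strand_next => ik; case: ifP => // _ [<-]; exact: leqW. Qed.

(** Enumeration is never undone, so only the test made last, at level [(k + d).-1], matters. *)
Lemma frun_strand en k d i : 0 < d -> frun (strand_next en) k d i =
  if enumerated_before en (k + d).-1 i then None else Some i.
Proof.
case: d => // d _; rewrite addnS /=; elim: d k => [|d IH] k.
  by rewrite addn0 /= /strand_next; case: ifP.
rewrite /= /strand_next; case: ifP => [H|_]; last by rewrite [LHS]IH addSnnS.
by rewrite (enumerated_before_mono (leq_addr _ _) H).
Qed.

(** The pair of [i] and [j] names position [i] at level [i + j + 1]; each vertex is named exactly
    once. *)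
Definition strand_point (m : nat) : fvertex id :=
  @fvert id ((unpair m).1 + (unpair m).2).+1 (unpair m).1 (leq_addr _ _).

Lemma strand_point_surj : set_surj setT setT strand_point.
Proof.
move=> u _; have lt := fpos_lt u.
exists (npair (fpos u) (flevel u - (fpos u).+1)) => //.
apply: fvertexP; rewrite /flevel /fpos /= unpairK //=.
by rewrite -addSn subnKC.
Qed.

Lemma strand_point_inj : injective strand_point.
Proof.
move=> m n [E1 E2]; rewrite -(npairK m) -(npairK n); congr npair => //.
by move/eqP: E1; rewrite E2 eqn_add2l => /eqP.
Qed.

Definition strand_presentation en : diagram_presentation (strands en) :=
  @DiagramPresentation (strands en) strand_point strand_point_surj.

Lemma strands_computably_presentable en :
  computable en -> computably_presentable (strands en).
Proof.
move=> Hen; exists (strand_presentation en); split=> //.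
- apply: (computable_ext (f := fun mn : nat * nat => mn.1 == mn.2)).
    by computability.
  move=> [m n] /=; apply/eqP/asboolP => [->//|]; exact: strand_point_inj.
- by rewrite /= /flevel /=; computability.
- rewrite /= /fedge /strand_next /enumerated_before /flevel /fpos /=.
  apply: (computable_ext (f := fun mn : nat * nat => nat_of_bool
    [&& ((unpair mn.2).1 + (unpair mn.2).2).+1 == ((unpair mn.1).1 + (unpair mn.1).2).+2,
      ~~ has (fun s => en s == (unpair mn.1).1.+1)
           (iota 0 ((unpair mn.1).1 + (unpair mn.1).2).+1) &
      (unpair mn.1).1 == (unpair mn.2).1])).
    by computability.
  by move=> [m n] /=; case: (_ || has _ _).
- exists id; split; first exact: computable_id.
  exact: card_flevel.
Qed.

(** If [e] is not enumerated before stage [e.+1 + b e.+1], its strand survives [b e.+1] levels and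
    therefore all levels, so that [e] is never enumerated. This bounds the search for a stage. *)
Lemma strands_effectively_live en : computable en ->
  effectively_live (strands en) -> computable_pred (fun e => exists s, en s = e.+1).
Proof.
move=> Hen [b Hb bP].
apply: (computable_ext (f := fun e => enumerated_before en (e.+1 + b e.+1) e)).
  by rewrite /enumerated_before; computability.
move=> e; apply/enumerated_beforeP/asboolP => [[s _ Es]|[s Es]]; first by exists s.
apply/enumerated_beforeP; apply: contrapT => /negP N.
pose u : strands en := @fvert id e.+1 e (leqnn _).
have liveE d : live d u <-> frun (strand_next en) e.+1 d e.
  exact: (live_fdiagram (@strand_next_lt en)).
have /(bP u)/(_ s.+1)/liveE : live (b e.+1) u.
  apply/liveE; case: (posnP (b e.+1)) => [->//|b0]; rewrite frun_strand //.
  by rewrite ifF //; apply: contraNF N; apply: enumerated_before_mono; lia.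
by rewrite frun_strand // ifT //; apply/enumerated_beforeP; exists s => //; lia.
Qed.

Lemma eternal_strands_effectively_live : effectively_live (strands (fun=> 0)).
Proof.
exists (fun=> 0); first exact: computable_cst.
move=> u _ d; apply/(live_fdiagram (@strand_next_lt _)).
case: (posnP d) => [->//|d0]; rewrite frun_strand //.
by case: enumerated_beforeP => // -[].
Qed.

(** * Equivalence of the strand diagrams *)

Section equivalence.
Variable en : nat -> nat.
Hypothesis infinitely_many_alive : forall e s, en s = e.+1 -> ~~ odd e.

Definition alive (e : nat) : bool := ~~ `[< exists s, en s = e.+1 >].

Lemma settled m : exists M, [/\ m < M,
  forall e, e < m -> ~~ alive e -> enumerated_before en M.-1 e &
  exists2 e, m <= e < M & alive e].
Proof.
have [N HN] : exists N, forall e, e < m -> ~~ alive e -> enumerated_before en N e.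
  elim: m => [|m [N HN]]; first by exists 0.
  have [am|/negPn/asboolP[s Es]] := boolP (alive m).
    exists N => e; rewrite ltnS leq_eqVlt => /orP[/eqP ->|]; last exact: HN.
    by rewrite am.
  exists (maxn N s.+1) => e; rewrite ltnS leq_eqVlt => /orP[/eqP ->|em ae].
    by move=> _; apply/enumerated_beforeP; exists s => //; rewrite leq_maxr.
  exact: enumerated_before_mono (leq_maxl _ _) (HN e em ae).
exists (maxn N m.*2.+1).+1; split=> /=.
- by rewrite ltnS leq_max; apply/orP; right; lia.
- by move=> e em ae; exact: enumerated_before_mono (leq_maxl _ _) (HN e em ae).
(* Odd numbers are never enumerated. *)
- exists m.*2.+1; first by rewrite ltnS leq_maxr andbT; lia.
  by apply/negP => /asboolP[s /infinitely_many_alive]; rewrite /= odd_double.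
Qed.

Definition settling (k : nat) : nat := iter k (fun m => sval (cid (settled m))) 0.

Lemma settlingS k : [/\ settling k < settling k.+1,
  forall e, e < settling k -> ~~ alive e -> enumerated_before en (settling k.+1).-1 e &
  exists2 e, settling k <= e < settling k.+1 & alive e].
Proof. by rewrite /settling /=; case: cid. Qed.

Definition alive_below (m : nat) : seq nat := [seq e <- iota 0 m | alive e].
(** For an alive [e] this is also the index of [e] in the increasing list of alive numbers. *)
Definition rank (m : nat) : nat := size (alive_below m).

Lemma rank_mono m p : m <= p -> rank m <= rank p.
Proof.
by move=> /subnKC <-; rewrite /rank /alive_below iotaD filter_cat size_cat leq_addr.
Qed.

Lemma rank_alive_lt e m : e < m -> alive e -> rank e < rank m.
Proof.
move=> em ae; apply: leq_trans (rank_mono em).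
by rewrite /rank /alive_below -[e.+1]addn1 iotaD filter_cat size_cat /= ae addn1.
Qed.

Lemma nth_rank e m : e < m -> alive e -> nth 0 (alive_below m) (rank e) = e.
Proof.
move=> em ae; rewrite /alive_below -(subnKC (ltnW em)) iotaD filter_cat nth_cat ltnn subnn.
by rewrite add0n -(@prednK (m - e)) ?subn_gt0 //= ae.
Qed.

Lemma nth_alive i m : i < rank m ->
  nth 0 (alive_below m) i < m /\ alive (nth 0 (alive_below m) i).
Proof.
by move=> im; have := mem_nth 0 im; rewrite mem_filter mem_iota => /and3P[].
Qed.

Lemma rank_nth i m : i < rank m -> rank (nth 0 (alive_below m) i) = i.
Proof.
move=> im; have [lt al] := nth_alive im; apply/eqP.
rewrite -(nth_uniq 0 (rank_alive_lt lt al) im) ?filter_uniq ?iota_uniq //.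
by rewrite nth_rank.
Qed.

Definition keep_alive (_ i : nat) : option nat := if alive i then Some i else None.

(* Levels alternate between the strands present at a settling time and those
   that remain alive forever below the next settling time. *)
Definition interleaved_width (j : nat) : nat :=
  if odd j then rank (settling j./2.+1) else settling j./2.
Definition interleaved_next (j i : nat) : option nat :=
  if odd j then Some (nth 0 (alive_below (settling j./2.+1)) i)
  else if alive i then Some (rank i) else None.

Lemma interleaved_next_lt j i i' : i < interleaved_width j ->
  interleaved_next j i = Some i' -> i' < interleaved_width j.+1.
Proof.
rewrite /interleaved_width /interleaved_next /= uphalf_half; case: (odd j) => /=.
  by move=> /nth_alive[lt _] [<-].
rewrite add0n; case: ifP => // ai ij [<-]; apply: rank_alive_lt => //.
by apply: ltn_trans ij _; have [] := settlingS j./2.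
Qed.

(** [E1] keeps the settling levels of the strands, [D1] only the eternal strands, renumbered by
    rank. Both are telescopings of the interleaved diagram [F], and each is a telescoping of one of
    the two diagrams to be compared. *)
Lemma strands_equivalent : diagram_equivalent (strands en) (strands (fun=> 0)).
Proof.
pose E1 := fdiagram settling keep_alive.
pose D1 := fdiagram (rank \o settling) (fun _ => Some).
pose F := fdiagram interleaved_width interleaved_next.
have lt k : settling k < settling k.+1 by have [] := settlingS k.
have E1E : telescoping E1 (strands en).
  apply: (fdiagram_telescoping (n := settling)) => //; first exact: strand_next_lt.
  move=> k i ik; rewrite frun_strand ?subn_gt0 // subnKC ?(ltnW (lt k)) //.
  have [_ st _] := settlingS k; rewrite /keep_alive.
  case: ifP => [ai|/negbT ai]; last by rewrite st.
  by rewrite ifF //; apply: contraTF ai => /enumerated_beforeP[s _ Es];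
    rewrite /alive asboolT //; exists s.
have E1F : telescoping E1 F.
  apply: (fdiagram_telescoping (n := double)) => //.
  - exact: interleaved_next_lt.
  - by move=> k; rewrite /interleaved_width odd_double doubleK.
  - move=> k i ik; rewrite -doubleB subSnn /= /interleaved_next /= odd_double /=.
    rewrite /keep_alive uphalf_double; case: ifP => // ai; rewrite nth_rank //.
    exact: ltn_trans ik (lt k).
have D1F : telescoping D1 F.
  (* Level 0, as every telescoping must keep it, followed by the odd levels; both [D1] and [F] are
     empty at level 0. *)
  apply: (fdiagram_telescoping (n := fun k => k.*2.-1)) => //.
  - exact: interleaved_next_lt.
  - by case.
  - case=> [|k] //=; rewrite /interleaved_width /= odd_double /= uphalf_double //.
  - case=> [|k] i //= ik.
    rewrite doubleS /= subSS -[k.*2.+2]addn2 -addnBAC // subnn add0n /=.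
    rewrite /interleaved_next /= odd_double /= uphalf_double.
    have [_ ->] := nth_alive ik; rewrite (rank_nth ik) //.
have D1D : telescoping D1 (strands (fun=> 0)).
  (* Level [k] of the uncut diagram has [k] vertices, so the level to keep is the width itself,
     which grows strictly by [settled]. *)
  apply: (fdiagram_telescoping (n := rank \o settling)) => //.
  - exact: strand_next_lt.
  - move=> k /=; have [_ _ [e /andP[ke ek] ae]] := settlingS k.
    exact: leq_ltn_trans (rank_mono ke) (rank_alive_lt ek ae).
  - move=> k i ik; set d := (_ - _); case: (posnP d) => [->//|d0].
    by rewrite frun_strand // ifF //; apply/enumerated_beforeP => -[].
exists 4, (nth (strands en) [:: strands en; E1; F; D1; strands (fun=> 0)]); split=> //.
case=> [|[|[|[|//]]]] _ /=.
- exact: Or33.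
- exact: Or32.
- exact: Or33.
- exact: Or32.
Qed.

End equivalence.

Lemma strands_not_computably_equivalent en : computable en ->
  ~ computable_pred (fun e => exists s, en s = e.+1) ->
  ~ diagram_computably_equivalent (strands en) (strands (fun=> 0)).
Proof.
move=> Hen undec /effectively_live_equivalent[_ H]; apply: undec.
exact: strands_effectively_live Hen (H eternal_strands_effectively_live).
Qed.

(** * Evaluation of star-polynomials *)

Notation rational_code := (int * nat)%type.
Notation monomial :=
  ((rational_code * rational_code) * ((nat * bool) * seq (nat * bool)))%type.

(** The generators take only the values 0 and 1, so a product is a conjunction and adjoints make no
    difference. *)
Definition word_at en (n : nat) (w : (nat * bool) * seq (nat * bool)) : bool :=
  gen_at en w.1.1 n && all (fun l => gen_at en l.1 n) w.2.

Definition monomial_den (t : monomial) : nat := t.1.1.2.+1 * t.1.2.2.+1.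

(* The state (d, ((a, b), (a', b'))) stands for the partial sum
   ((a - b) + (a' - b') i) / d. *)
Definition poly_step en (n : nat) (s : nat * ((nat * nat) * (nat * nat))) (t : monomial) :=
  (s.1 * monomial_den t,
   ((s.2.1.1 * monomial_den t + word_at en n t.2 * (s.1 * t.1.2.2.+1 * int_pos t.1.1.1),
     s.2.1.2 * monomial_den t + word_at en n t.2 * (s.1 * t.1.2.2.+1 * int_neg t.1.1.1)),
    (s.2.2.1 * monomial_den t + word_at en n t.2 * (s.1 * t.1.1.2.+1 * int_pos t.1.2.1),
     s.2.2.2 * monomial_den t + word_at en n t.2 * (s.1 * t.1.1.2.+1 * int_neg t.1.2.1)))).

Definition poly_at en (n : nat) (p : seq monomial) :=
  foldl (poly_step en n) (1, ((0, 0), (0, 0))) p.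

(** Truncated differences in both directions add up to an absolute value. *)
Definition sqnorm_num (s : nat * ((nat * nat) * (nat * nat))) : nat :=
  ((s.2.1.1 - s.2.1.2) + (s.2.1.2 - s.2.1.1)) ^ 2 +
  ((s.2.2.1 - s.2.2.2) + (s.2.2.2 - s.2.2.1)) ^ 2.

(** The points up to [code p] represent all others, and numerators can be compared because the
    denominator is the same at all points. *)
Definition max_sqnorm_num en (p : seq monomial) : nat :=
  \max_(n < (code p).+1) sqnorm_num (poly_at en n p).

Lemma computable_poly_at en : computable en ->
  computable (fun x : nat * seq monomial => poly_at en x.1 x.2).
Proof.
move=> Hen; have Hg := computable_gen_at Hen.
have Hw : computable (fun x : nat * ((nat * bool) * seq (nat * bool)) => word_at en x.1 x.2).
  rewrite /word_at; computability.
    by apply: (computable_comp (f := fun x : nat * ((nat * bool) * seq (nat * bool)) =>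
      (x.2.1.1, x.1)) Hg); computability.
  apply: computable_all; computability.
  by apply: (computable_comp (f := fun x : nat * ((nat * bool) * seq (nat * bool)) *
    (nat * bool) => (x.2.1, x.1.1)) Hg); computability.
apply: computable_foldl; rewrite /poly_step /monomial_den; computability;
  by apply: (computable_comp (f := fun y : nat * seq monomial *
    ((nat * ((nat * nat) * (nat * nat))) * monomial) => (y.1.1, y.2.2.2)) Hw);
    computability.
Qed.

Lemma computable_max_sqnorm_num en : computable en -> computable (max_sqnorm_num en).
Proof.
move=> Hen; have Hp := computable_poly_at Hen.
have H : computable (fun y : seq monomial * nat => poly_at en y.2 y.1).
  by apply: (computable_comp (f := fun y : seq monomial * nat => (y.2, y.1)) Hp);
    computability.
by apply: (computable_bigmax (F := fun p n => sqnorm_num (poly_at en n p))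
  (n := fun p => (code p).+1)); rewrite /sqnorm_num; computability.
Qed.

Lemma computable_sqrt : exists r : nat -> nat, computable r /\
  forall n, r n ^ 2 <= n < (r n).+1 ^ 2.
Proof.
have [|n|r [Hr rP]] := @computable_mu nat _ (fun n m => (m ^ 2 <= n) && (n < m.+1 ^ 2)).
- by computability.
- elim: n => [|n [m /andP[mn nm]]]; first by exists 0.
  have [le|lt] := leqP (m.+1 ^ 2) n.+1; last by exists m; rewrite lt leqW.
  by exists m.+1; rewrite le /=; apply: leq_ltn_trans nm _; rewrite ltn_sqr.
- by exists r.
Qed.

Lemma leq_code_fst (A B : Type) {cA : coded A} {cB : coded B} (x : A * B) :
  code x.1 <= code x.
Proof. exact: leq_npairl. Qed.

Lemma leq_code_snd (A B : Type) {cA : coded A} {cB : coded B} (x : A * B) :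
  code x.2 <= code x.
Proof. exact: leq_npairr. Qed.

Lemma code_letter_monomial (p : seq monomial) (t : monomial) (l : nat * bool) : t \in p ->
  l \in t.2.1 :: t.2.2 -> l.1 < code p.
Proof.
move=> tp lt.
have lt2 : l.1 <= code t.2.
  move: lt; rewrite in_cons => /orP[/eqP ->|/code_letter/ltnW H].
    exact: leq_trans (leq_code_fst t.2.1) (leq_code_fst t.2).
  exact: leq_trans H (leq_code_snd t.2).
have H : l.1 <= code t by exact: leq_trans lt2 (leq_code_snd t).
elim: p tp => //= a p IH; rewrite in_cons ltnS => /orP[/eqP E|/IH {}H].
  by rewrite -E; apply: leq_trans H (leq_npairl _ _).
exact: leq_trans (ltnW H) (leq_npairr _ _).
Qed.

Lemma poly_at_bounded en n p :
  exists2 m, m < (code p).+1 & poly_at en n p = poly_at en m p.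
Proof.
have [m mb H] := gen_at_bounded en n (ltn0Sn (code p)); exists m => //.
have E t : t \in p -> word_at en n t.2 = word_at en m t.2.
  move=> tp; have L l (lt : l \in t.2.1 :: t.2.2) : gen_at en l.1 n = gen_at en l.1 m.
    by apply: H; apply: ltnW; exact: code_letter_monomial tp lt.
  rewrite /word_at (L _ (mem_head _ _)); congr andb; apply: eq_in_all => l lt.
  by apply: L; rewrite in_cons lt orbT.
rewrite /poly_at; elim: p (1, _) E {H mb} => //= t p IH s E.
rewrite IH; first by rewrite /poly_step E ?mem_head.
by move=> u up; rewrite E // in_cons up orbT.
Qed.

(** * Eventually constant integer sequences *)

Import Order.TTheory GRing.Theory Num.Theory.
Local Open Scope ring_scope.

(* {poly int} stands for the group of eventually constant integer sequences:
   the constant coefficient is the value at omega (the point 0), the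
   coefficient of 'X^n the difference between the values at n and at omega. *)
Definition ev (p : {poly int}) (n : nat) : int := p`_0 + (if n is 0%N then 0 else p`_n).

Lemma evD p q n : ev (p + q) n = ev p n + ev q n.
Proof. by rewrite /ev !coefD; case: n => [|n]; rewrite ?coefD ?addr0 // addrACA. Qed.

Lemma evN p n : ev (- p) n = - ev p n.
Proof. by rewrite /ev !coefN; case: n => [|n]; rewrite ?coefN ?oppr0 ?addr0 // opprD. Qed.

Lemma evB p q n : ev (p - q) n = ev p n - ev q n.
Proof. by rewrite evD evN. Qed.

Lemma ev0 n : ev 0 n = 0.
Proof. by rewrite /ev !coef0; case: n => [|n]; rewrite ?coef0 addr0. Qed.

Lemma evMn p k n : ev (p *+ k) n = ev p n *+ k.
Proof. by elim: k => [|k IH]; rewrite ?mulr0n ?ev0 // !mulrS evD IH. Qed.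

Lemma ev1 n : ev 1 n = 1.
Proof. by rewrite /ev coef1; case: n => [|n]; rewrite ?coef1 addr0. Qed.

Lemma evXn k n : (0 < k)%N -> ev 'X^k n = (n == k)%:Z.
Proof.
by case: k => // k _; rewrite /ev coefXn add0r; case: n => [|n] //; rewrite coefXn natz.
Qed.

Lemma ev_inj p q : (forall n, ev p n = ev q n) -> p = q.
Proof.
move=> E; have E0 : p`_0 = q`_0 by have := E 0%N; rewrite /ev !addr0.
apply/polyP => -[|n] //; have := E n.+1; rewrite /ev E0; exact: addrI.
Qed.

Lemma ev_far (p : {poly int}) n : (size p <= n)%N -> ev p n = ev p 0.
Proof. by case: n => // n; rewrite /ev => H; rewrite (nth_default _ H). Qed.

Lemma ev_surj (f : nat -> int) : (exists N, forall n, (N <= n)%N -> f n = f 0%N) ->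
  exists p, forall n, ev p n = f n.
Proof.
move=> [N HN]; exists (\poly_(i < N.+1) (if i is 0%N then f 0%N else f i - f 0%N)) => n.
rewrite /ev; case: n => [|n]; rewrite !coef_poly /= ?addr0 //.
case: ltnP => [_|/ltnW/HN ->]; last by rewrite addr0.
by rewrite addrCA subrr addr0.
Qed.

Definition ev_cone : set {poly int} := [set p | forall n, 0 <= ev p n].

Lemma ev_coneD x y : ev_cone x -> ev_cone y -> ev_cone (x + y).
Proof. by move=> Hx Hy n; rewrite evD addr_ge0. Qed.

Lemma ev_cone_pointed : (ev_cone `&` [set - x | x in ev_cone] = [set 0])%classic.
Proof.
apply/seteqP; split=> [z [z0 [x x0 xz]]|_ ->] /=; last first.
  by split=> [n|]; [rewrite ev0|exists 0; rewrite ?oppr0 // => n; rewrite ev0].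
apply: ev_inj => n; rewrite ev0; apply: le_anti; rewrite z0 andbT.
by rewrite -xz evN oppr_le0.
Qed.

Lemma ev_bounded (p : {poly int}) : exists k : nat, forall n, `|ev p n| <= k%:Z.
Proof.
exists (\max_(i < (size p).+1) `|ev p i|%N) => n; rewrite -abszE lez_nat.
have [lt|/ltnW/ev_far ->] := ltnP n (size p).+1; last first.
  exact: (leq_bigmax (ord0 : 'I_(size p).+1)).
exact: (leq_bigmax (Ordinal lt)).
Qed.

Lemma ev_cone_spans : ([set x - y | x in ev_cone & y in ev_cone] = [set: {poly int}])%classic.
Proof.
apply/seteqP; split=> // p _; have [k Hk] := ev_bounded p.
exists (p + 1 *+ k); last first.
  exists (1 *+ k); last by rewrite addrK.
  by move=> n; rewrite evMn ev1 mulrn_wge0.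
move=> n; rewrite evD evMn ev1 -lerBlDr sub0r natz.
by rewrite lerNl; apply: le_trans (Hk n); rewrite -normrN ler_norm.
Qed.

Definition seq_group : oabGroup := OAbGroup ev_coneD ev_cone_pointed ev_cone_spans.

Lemma seq_group_unit : order_unit (1 : seq_group).
Proof.
split=> [n|p]; first by rewrite ev1.
have [k Hk] := ev_bounded p; exists k.+1.
have Hk' n : `|ev p n| <= k.+1%:Z by apply: le_trans (Hk n) _; rewrite lez_nat.
split=> // n; rewrite evB ?evN evMn ev1 natz subr_ge0; move: (Hk' n);
  by rewrite ler_norml => /andP[].
Qed.

Definition unital_seq_group : unitalGroup := UnitalGroup seq_group_unit.

(** * The sequence group as an inductive limit *)

Section seq_group_limit.

(* The vector v stands for the sequence with value v_j at the points j <= s and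
   v_0 elsewhere. *)
Definition seq_limit_step s (v : Zn s.+1) : Zn s.+2 :=
  \row_j (if insub (j : nat) is Some i then v ord0 i else v ord0 ord0).

Definition truncate s (p : seq_group) : Zn s.+1 := \row_(j < s.+1) ev p j.

Lemma seq_limit_stepE s (v : Zn s.+1) i j :
  seq_limit_step v i j = if insub (j : nat) is Some k then v ord0 k else v ord0 ord0.
Proof. exact: mxE. Qed.

Lemma truncateE s p i j : truncate s p i j = ev p j.
Proof. exact: mxE. Qed.

Lemma seq_limit_map_exists s (v : Zn s.+1) : exists p : seq_group,
  forall n, ev p n = if insub n is Some i then v ord0 i else v ord0 ord0.
Proof.
apply: ev_surj; exists s.+1 => n sn; rewrite insubF; last by rewrite ltnNge sn.
by case: insubP => //= i _ i0; congr (v _ _); apply: val_inj.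
Qed.

Definition seq_limit_map s (v : Zn s.+1) : seq_group := sval (cid (seq_limit_map_exists v)).

Lemma ev_seq_limit_map s (v : Zn s.+1) n :
  ev (seq_limit_map v) n = if insub n is Some i then v ord0 i else v ord0 ord0.
Proof. by rewrite /seq_limit_map; case: cid. Qed.

Lemma truncateK s (p : seq_group) : (size (p : {poly int}) <= s.+1)%N ->
  seq_limit_map (truncate s p) = p.
Proof.
move=> ps; apply: ev_inj => n; rewrite ev_seq_limit_map.
case: insubP => [i _ <-|]; rewrite truncateE //= -leqNgt => sn.
by rewrite (ev_far (leq_trans ps sn)).
Qed.

Lemma truncate_step s (p : seq_group) : (size (p : {poly int}) <= s.+1)%N ->
  seq_limit_step (truncate s p) = truncate s.+1 p.
Proof.
move=> ps; apply/rowP => j; rewrite seq_limit_stepE [RHS]truncateE.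
case: insubP => [i _ <-|]; rewrite truncateE //= -leqNgt => sn.
by rewrite (ev_far (leq_trans ps sn)).
Qed.

Lemma seq_limit_mapK s (v : Zn s.+1) : truncate s (seq_limit_map v) = v.
Proof.
apply/rowP => j; rewrite truncateE ev_seq_limit_map insubT // => lt.
by congr (v _ _); apply: val_inj.
Qed.

Lemma seq_limit_mapD s : {morph @seq_limit_map s : x y / x + y}.
Proof.
move=> x y; apply: ev_inj => n; rewrite evD !ev_seq_limit_map.
by case: insubP => [i|] *; rewrite mxE.
Qed.

Lemma seq_limit_map_step s (v : Zn s.+1) :
  seq_limit_map (seq_limit_step v) = seq_limit_map v.
Proof.
apply: ev_inj => n; rewrite !ev_seq_limit_map.
have E0 : (if insub ((ord0 : 'I_s.+2) : nat) is Some i then v ord0 i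
    else v ord0 ord0) = v ord0 ord0.
  by case: insubP => //= i _ i0; congr (v _ _); apply: val_inj.
case: insubP => [i _ <-|]; first by rewrite seq_limit_stepE.
rewrite -leqNgt => sn; rewrite seq_limit_stepE E0 insubF //.
by rewrite ltnNge ltnW.
Qed.

Lemma truncateD s (p q : seq_group) : truncate s (p + q) = truncate s p + truncate s q.
Proof. by apply/rowP => j; rewrite !(truncateE, mxE) evD. Qed.

(** Every eventually constant sequence is the image of its truncations at late stages, which
    determines the factorisation of a cocone and makes it unique. *)
Lemma seq_group_dimension : dimension_group seq_group.
Proof.
exists succn, seq_limit_step, seq_limit_map; split.
  move=> s; split=> [x y|x x0 j]; last by rewrite seq_limit_stepE; case: insub.
  apply/rowP => j; rewrite [RHS]mxE !seq_limit_stepE.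
  by case: insub => [i|]; rewrite mxE.
split.
  move=> s; split=> [|x]; last exact: seq_limit_map_step.
  split; first exact: seq_limit_mapD.
  by move=> x x0 n; rewrite ev_seq_limit_map; case: insub.
move=> H c Hc.
have cD s x y : c s (x + y) = c s x + c s y by have [[->]] := Hc s.
(* All stages late enough for [p] give the same value, so the factorisation [h] may be read off at
   stage [size p]. *)
have c_stable p s : (size (p : {poly int}) <= s.+1)%N ->
    c s (truncate s p) = c (size (p : {poly int})) (truncate (size (p : {poly int})) p).
  move=> ps; have stepS t : (size (p : {poly int}) <= t.+1)%N ->
      c t.+1 (truncate t.+1 p) = c t (truncate t p).
    by move=> pt; rewrite -truncate_step //; have [_ ->] := Hc t.
  have [/subnKC <-|lt] := leqP (size (p : {poly int})) s.
    elim: (s - _)%N => [|d IH]; first by rewrite addn0.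
    by rewrite addnS stepS ?IH // leqW // leq_addr.
  have -> : size (p : {poly int}) = s.+1 by apply/eqP; rewrite eqn_leq ps.
  by rewrite stepS.
pose h (p : seq_group) := c (size (p : {poly int})) (truncate (size (p : {poly int})) p).
have hE s x : h (seq_limit_map x) = c s x.
  pose p := seq_limit_map x; pose t := maxn s (size (p : {poly int})).
  rewrite /h -(c_stable _ t) ?leqW ?leq_maxr //.
  have : (s <= t)%N by rewrite leq_maxl.
  move=> /subnKC <-; elim: (t - s)%N => [|d IH]; first by rewrite addn0 seq_limit_mapK.
  rewrite -IH addnS -truncate_step; first by have [_ ->] := Hc (s + d)%N.
  (* Beyond [s] the image of [x] has its value at omega, hence zero coefficients. *)
  apply/leq_sizeP => j sj; have := ev_seq_limit_map x j; have := ev_seq_limit_map x 0.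
  rewrite /ev; case: j sj => // j sj; rewrite addr0.
  case: insubP => //= i _ i0 ->; rewrite insubF; last first.
    by rewrite ltnNge (leq_trans _ sj) // ltnS leq_addr.
  have -> : i = ord0 by apply: val_inj.
  by move/(canRL (addKr _)) ->; rewrite addNr.
exists h; split.
  split=> //; split=> [x y|x x0].
    pose t := maxn (size (x : {poly int})) (size (y : {poly int})).
    rewrite /h -(c_stable (x + y) t); last first.
      by rewrite leqW //; exact: size_polyD.
    rewrite -(c_stable x t) ?leqW ?leq_maxl // -(c_stable y t) ?leqW ?leq_maxr //.
    by rewrite truncateD cD.
  by rewrite /h; have [[_ +] _] := Hc (size (x : {poly int})); apply => j; rewrite truncateE.
move=> h' [_ Hh']; apply: funext => p.
rewrite -(@truncateK (size (p : {poly int})) p) ?leqW //.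
by rewrite hE Hh'.
Qed.

End seq_group_limit.

Definition word_pos en (n : nat) (w : seq (nat * bool)) : nat :=
  count (fun l => ~~ l.2 && gen_at en l.1 n) w.
Definition word_neg en (n : nat) (w : seq (nat * bool)) : nat :=
  count (fun l => l.2 && gen_at en l.1 n) w.

Definition word_nonneg en (w : seq (nat * bool)) : bool :=
  all (fun n => word_neg en n w <= word_pos en n w)%N (iota 0 (code w).+1).
Definition word_zero en (w : seq (nat * bool)) : bool :=
  all (fun n => word_neg en n w == word_pos en n w) (iota 0 (code w).+1).

Lemma word_bounded en n w : exists2 m, (m < (code w).+1)%N &
  word_pos en n w = word_pos en m w /\ word_neg en n w = word_neg en m w.
Proof.
have [m mb H] := gen_at_bounded en n (ltn0Sn (code w)); exists m => //.
by split; apply: eq_in_count => l /code_letter lw; rewrite H // ltnW.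
Qed.

Lemma computable_word_tests en : computable en ->
  computable (word_nonneg en) /\ computable (word_zero en).
Proof.
move=> Hen; have Hg := computable_gen_at Hen.
have Hg' : computable (fun y : nat * seq (nat * bool) * (nat * bool) =>
    gen_at en y.2.1 y.1.1).
  by apply: (computable_comp (f := fun y : nat * seq (nat * bool) * (nat * bool) =>
    (y.2.1, y.1.1)) Hg); computability.
have Hp : computable (fun x => word_pos en x.1 x.2).
  by apply: computable_count; computability.
have Hn : computable (fun x => word_neg en x.1 x.2).
  by apply: computable_count; computability.
pose sw (y : seq (nat * bool) * nat) := (y.2, y.1).
have Hs : computable sw by rewrite /sw; computability.
have Hp' := computable_comp Hp Hs; have Hn' := computable_comp Hn Hs.
by split; apply: computable_all_iota; computability.
Qed.

(** * Presentations of the sequence group *)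

Section presentation.
Variable en : nat -> nat.
Hypothesis en_inj : forall s t, (0 < en s)%N -> en s = en t -> s = t.

Lemma gen_poly_exists j : exists p : seq_group, forall n, ev p n = (gen_at en j n)%:Z.
Proof.
apply: ev_surj; have [N HN] := gen_at_eventually j en_inj.
by exists N => n /HN ->.
Qed.

Definition gen_poly j : seq_group := sval (cid (gen_poly_exists j)).

Lemma ev_gen_poly j n : ev (gen_poly j) n = (gen_at en j n)%:Z.
Proof. by rewrite /gen_poly; case: cid. Qed.

Definition word_poly (w : seq (nat * bool)) : seq_group :=
  \sum_(l <- w) (if l.2 then - gen_poly l.1 else gen_poly l.1).

Lemma ev_word_poly w n : ev (word_poly w) n = (word_pos en n w)%:Z - (word_neg en n w)%:Z.
Proof.
rewrite /word_poly; elim: w => [|l w IH]; first by rewrite big_nil ev0 subrr.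
have E : ev (if l.2 then - gen_poly l.1 else gen_poly l.1) n =
    (~~ l.2 && gen_at en l.1 n)%:Z - (l.2 && gen_at en l.1 n)%:Z.
  by case: l => j [] /=; rewrite ?evN ev_gen_poly ?sub0r ?subr0.
by rewrite big_cons evD IH E /= !PoszD opprD addrACA.
Qed.

Lemma word_nonnegP w : word_nonneg en w <-> ev_cone (word_poly w).
Proof.
split=> [/allP H n|H]; last first.
  by apply/allP => n _; have := H n; rewrite ev_word_poly subr_ge0 lez_nat.
have [m mb [Ep En]] := word_bounded en n w.
by rewrite ev_word_poly Ep En subr_ge0 lez_nat; apply: H; rewrite mem_iota.
Qed.

Lemma word_zeroP w : word_zero en w <-> word_poly w = 0.
Proof.
split=> [/allP H|H]; last first.
  apply/allP => n _; have := ev_word_poly w n; rewrite H ev0 => /esym/eqP.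
  by rewrite subr_eq0 eq_sym => /eqP[->].
apply: ev_inj => n; have [m mb [Ep En]] := word_bounded en n w.
rewrite ev0 ev_word_poly Ep En; apply/eqP; rewrite subr_eq0 eq_sym; apply/eqP; congr Posz.
by apply/eqP/H; rewrite mem_iota.
Qed.

Lemma word_poly_mul (v w : free_group) :
  word_poly (v * w)%g = word_poly v + word_poly w.
Proof.
have push a u : word_poly (fpush a u) = word_poly [:: a] + word_poly u.
  case: u => [|b u] /=; first by rewrite {3}/word_poly big_nil addr0.
  case: eqP => [->|_]; rewrite /word_poly !big_cons big_nil addr0 //=.
  by case: a => j [] /=; rewrite ?addNKr ?addKr // addrA subrr add0r.
have -> : free_word (v * w)%g = fmulw v w by [].
rewrite /fmulw; elim: (free_word v) => [|a u IH] /=.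
  by rewrite {2}/word_poly big_nil add0r.
by rewrite push IH addrA; congr (_ + _); rewrite /word_poly !big_cons big_nil addr0.
Qed.

(** The image is a subgroup containing every power of ['X]: the power 0 is the constant generator,
    the others are generators or differences of two by [gen_at_split]. *)
Lemma word_poly_surj : set_surj setT setT (fun w : free_group => word_poly w).
Proof.
pose img (p : {poly int}) := exists w : free_group, word_poly w = p.
have img0 : img 0 by exists 1%g; rewrite /word_poly big_nil.
have imgD p q : img p -> img q -> img (p + q).
  by move=> [v <-] [w <-]; exists (v * w)%g; rewrite word_poly_mul.
have imgN p : img p -> img (- p).
  move=> [w <-]; exists (w^-1)%g; apply/eqP; rewrite -addr_eq0 -word_poly_mul mulVg.
  by rewrite /word_poly big_nil.
have img_gen j : img (gen_poly j).
  by exists (@FreeWord [:: (j, false)] isT); rewrite /word_poly big_seq1.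
have imgX n : img 'X^n.
  case: (posnP n) => [->|n0].
    rewrite (_ : 'X^0 = gen_poly 0) //; apply: ev_inj => k.
    by rewrite ev_gen_poly expr0 ev1.
  have [H|[m [m0 mn Hn Hm]]] := gen_at_split en_inj n0.
    by rewrite (_ : 'X^n = gen_poly n) //; apply: ev_inj => k; rewrite ev_gen_poly H evXn.
  rewrite (_ : 'X^n = gen_poly n - gen_poly m); first exact/imgD/imgN/img_gen/img_gen.
  apply: ev_inj => k; rewrite evB !ev_gen_poly Hn Hm evXn //.
  by case: (eqVneq k m) mn => [->|]; rewrite ?orbF ?subr0 // => /negPf ->.
move=> p _; suff [w Hw] : img p by exists w.
rewrite -[p](coefK p) poly_def; apply: big_ind => // i _.
have imgMn q k : img q -> img (q *+ k).
  by move=> Hq; elim: k => [|k IH]; rewrite ?mulr0n // mulrS; exact: imgD.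
rewrite -[p`_i]intz scaler_int; case: (p`_i) => k; first exact: imgMn.
by rewrite NegzE mulrNz; apply/imgN/imgMn.
Qed.

Definition seq_group_presentation : group_presentation unital_seq_group :=
  @GroupPresentation unital_seq_group (fun w => word_poly w) word_poly_mul word_poly_surj.

Lemma seq_group_presentation_ce : computable en -> ce_presentation seq_group_presentation.
Proof.
move=> /computable_word_tests[H1 H2].
have H0 : computable free_word by apply: computable_recode (@computable_id free_group _) _.
split; apply: computable_pred_ce.
  apply: computable_ext (computable_comp H2 H0) _ => w.
  by apply/idP/asboolP => /word_zeroP.
apply: computable_ext (computable_comp H1 H0) _ => w.
by apply/idP/asboolP => /word_nonnegP.
Qed.

End presentation.

(** * Atoms of the sequence group *)

Section atoms.

Definition atom (G : oabGroup) (p : G) : Prop :=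
  [/\ cone p, p <> 0 & forall q, cone q -> cone (p - q) -> q = 0 \/ q = p].

Lemma unital_isomorphism_atom (G H : unitalGroup) (phi : G -> H) p :
  unital_isomorphism phi -> atom (phi p) -> atom p.
Proof.
move=> [bij phiD phi_cone _] [cp p0 min].
have phi0 : phi 0 = 0 by apply: (addrI (phi 0)); rewrite -phiD !addr0.
have phiN x : phi (- x) = - phi x.
  by apply: (addrI (phi x)); rewrite -phiD !subrr.
split; [exact/phi_cone|by move=> E; apply: p0; rewrite E|move=> q cq cpq].
have [||E|E] := min (phi q); first exact/phi_cone.
- by rewrite -phiN -phiD; exact/phi_cone.
- by left; apply: (bij_inj bij); rewrite phi0.
- by right; apply: (bij_inj bij).
Qed.

(** An integer sequence between 0 and ['X^n] vanishes off [n] and is 0 or 1 at [n]. *)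
Lemma atomX n : (0 < n)%N -> @atom seq_group 'X^n.
Proof.
move=> n0; split=> [k||q cq cpq]; first by rewrite evXn.
  by move/(congr1 (ev ^~ n)); rewrite evXn // ev0 eqxx.
have Hk k : ev q k = if k == n then ev q n else 0.
  case: eqP => [->//|kn]; have := cpq k; rewrite evB evXn //; move/eqP/negPf: kn => ->.
  by rewrite sub0r oppr_ge0 => H; apply/eqP; rewrite eq_le H cq.
have := cpq n; rewrite evB evXn // eqxx subr_ge0; have := cq n; have := Hk.
case: (ev q n) => // -[|[|//]] H _ _; [left|right]; apply: ev_inj => k.
  by rewrite H ev0; case: eqP.
by rewrite H evXn //; case: eqP.
Qed.

(** The indicator of the second point [s.*2.+2] lies strictly between 0 and the generator; parity
    tells the two points apart. *)
Lemma not_atom_gen_poly en (en_inj : forall s t, (0 < en s)%N -> en s = en t -> s = t) e :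
  (exists s, en s = e.+1) -> ~ atom (gen_poly en_inj e.*2.+1).
Proof.
move=> [s Es] [_ _ min]; have [g1 g2] := gen_at_odd_enumerated Es.
have [||/(congr1 (ev ^~ s.*2.+2))|/(congr1 (ev ^~ e.*2.+1))] := min 'X^(s.*2.+2).
- by move=> k; rewrite evXn.
- move=> k; rewrite evB evXn // ev_gen_poly; case: eqP => [->|_]; first by rewrite g2.
  by rewrite subr0.
- by rewrite evXn // ev0 eqxx.
- rewrite evXn // ev_gen_poly g1; case: eqP => // /(congr1 odd).
  by rewrite /= !odd_double.
Qed.

Lemma atom_gen_poly en (en_inj : forall s t, (0 < en s)%N -> en s = en t -> s = t) e :
  ~ (exists s, en s = e.+1) -> atom (gen_poly en_inj e.*2.+1).
Proof.
move=> N; rewrite (_ : gen_poly en_inj e.*2.+1 = 'X^(e.*2.+1)); first exact: atomX.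
by apply: ev_inj => k; rewrite ev_gen_poly gen_at_not_enumerated // evXn.
Qed.

(** An atom is positive at some finite ordinal, since a positive value at omega is taken at all far
    points as well. Having integer values, it then lies above the indicator of that ordinal and
    equals it by minimality. *)
Lemma seq_group_atomP (p : seq_group) : atom p -> exists n, p = 'X^(n.+1).
Proof.
move=> [cp p0 min]; have [n Hn] : exists n, 0 < ev p n.+1.
  have [p00|p00] := eqVneq (ev p 0) 0.
    apply: contrapT => N; apply: p0; apply: ev_inj => -[|n]; rewrite ev0 //.
    apply/eqP; rewrite eq_le cp andbT leNgt; apply/negP => H.
    by apply: N; exists n.
  exists (size (p : {poly int})); rewrite ev_far // lt_neqAle eq_sym p00; exact: cp.
exists n; case: (min 'X^(n.+1)) => // [k|k|].
- by rewrite evXn.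
- rewrite evB evXn // subr_ge0; case: eqP => [->|_]; first by rewrite -gtz0_ge1.
  exact: cp.
- by move/(congr1 (ev ^~ n.+1)); rewrite evXn // ev0 eqxx.
Qed.

End atoms.

Lemma no_enumeration_inj s t : (0 < (fun _ : nat => 0%N) s)%N ->
  (fun=> 0%N) s = (fun=> 0%N) t -> s = t.
Proof. by []. Qed.

(* An isomorphism maps the generator e.*2.+1 to an atom if and only if e is not
   enumerated, so that searching for an atom with the same label or for a stage
   at which e is enumerated would decide the enumerated set. *)
Lemma seq_group_presentations_not_isomorphic en
    (en_inj : forall s t, (0 < en s)%N -> en s = en t -> s = t) :
  computable en -> ~ computable_pred (fun e => exists s, en s = e.+1) ->
  ~ computably_group_isomorphic (seq_group_presentation en_inj)
      (seq_group_presentation no_enumeration_inj).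
Proof.
move=> Hen undec [phi [iso [f [Hf phiE]]]]; apply: undec.
pose g e : free_group := @FreeWord [:: (e.*2.+1, false)] isT.
have Hg : computable g.
  apply: (computable_recode (f := fun e => [:: (e.*2.+1, false)])) => //.
  by computability.
have H0 : computable free_word by apply: computable_recode (@computable_id free_group _) _.
have [_ Hz] := computable_word_tests (@computable_cst nat _ nat _ 0%N).
have gE e : word_poly en_inj (g e) = gen_poly en_inj e.*2.+1.
  by rewrite /word_poly big_seq1.
have XE n : gen_poly no_enumeration_inj n.+1 = 'X^(n.+1).
  by apply: ev_inj => k; rewrite ev_gen_poly gen_at_none evXn // (eq_sym k).
(* The word names the image of the generator [e.*2.+1] minus ['X^(m.+1)]. *)
pose P e m := (en m == e.+1) || word_zero (fun=> 0%N) ((m.+1, true) :: f (g e)).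
have PE e m : word_zero (fun=> 0%N) ((m.+1, true) :: f (g e)) <->
    phi (gen_poly en_inj e.*2.+1) = 'X^(m.+1).
  rewrite (word_zeroP no_enumeration_inj) {1}/word_poly big_cons /= XE addrC.
  rewrite -[\sum_(l <- _) _]/(word_poly no_enumeration_inj (f (g e))).
  rewrite -gE -[word_poly en_inj _]/(seq_group_presentation en_inj (g e)) -phiE.
  split=> [/eqP|E]; first by rewrite subr_eq0 => /eqP.
  by apply/eqP; rewrite subr_eq0; apply/eqP.
have [||m [Hm Pm]] := @computable_mu nat _ P.
- by rewrite /P; computability.
- move=> e; have [[s Es]|N] := pselect (exists s, en s = e.+1).
    by exists s; rewrite /P Es eqxx.
  have [bij phiD phi_cone phi1] := iso; have [psi psiK phiK] := bij.
  have [n Hn] : exists n, phi (gen_poly en_inj e.*2.+1) = 'X^(n.+1).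
    apply: seq_group_atomP; apply: (@unital_isomorphism_atom _ unital_seq_group psi).
      split=> [|x y|x|]; [by exists phi| | |].
      - by apply: (can_inj psiK); rewrite phiD !phiK.
      - by rewrite -{2}(phiK x); split=> /phi_cone.
      - by apply: (can_inj psiK); rewrite phiK phi1.
    by rewrite psiK; exact: atom_gen_poly.
  by exists n; rewrite /P; apply/orP; right; apply/PE.
(* For an enumerated [e] the image is no atom, so the search can only have stopped at the stage of
   enumeration. *)
apply: (computable_ext (f := fun e => en (m e) == e.+1)); first by computability.
move=> e; apply/eqP/asboolP => [E|W]; first by exists (m e).
have /orP[/eqP//|/PE E] := Pm e.
case: (not_atom_gen_poly (en_inj := en_inj) W); apply: (unital_isomorphism_atom iso).
by rewrite E; exact: atomX.
Qed.

(** * Continuous functions on omega + 1 *)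

Import numFieldNormedType.Exports.

Section omega1_topology.

(** An open interval containing omega has no right end, so it contains all finite ordinals from some
    point on. *)
Lemma nbhs_omega (B : set omega1_top) :
  nbhs (None : omega1_top) B <-> exists N, forall x : omega1_top,
    (if x is Some n then (N <= n)%N else true) -> B x.
Proof.
rewrite itv_nbhsE; split=> [[i [io iN] iB]|[N HN]]; last first.
  exists `]Some N : omega1_top, +oo[; first by split.
  move=> [n|] xn; apply: HN => //.
  by move: xn; rewrite /= in_itv /= andbT => /ltW.
have [N HN] : exists N, forall n, (N <= n)%N -> B (Some n : omega1_top).
  case: i io iN iB => -[bl l|[]] [br r|[]] //= io iN iB.
  - by case: br r io iN {iB} => [] [r|]; case: bl l => [] [l|].
  - by case: bl l io iN {iB} => [] [l|].
  - case: bl l io iN iB => [] [l|] // _ _ iB.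
    exists l.+1 => m lm; apply: iB; rewrite /= in_itv /= andbT.
    suff : ((Some l : omega1) < Some m)%O by [].
    rewrite lt_neqAle; apply/andP; split; last exact: ltnW.
    by apply/eqP => -[lm']; rewrite lm' ltnn in lm.
  - by case: br r io iN {iB} => [] [r|].
  - by exists 0%N => m _; apply: iB; rewrite /= in_itv.
by exists N => -[n|] H; [exact: HN|exact: iB].
Qed.

Lemma nbhs_finite_ordinal n : nbhs (Some n : omega1_top) [set Some n].
Proof.
have lt (j k : nat) : ((Some j : omega1_top) < Some k)%O = (j < k)%N.
  by rewrite lt_neqAle [(_ <= _)%O]/(j <= k)%N ltn_neqAle.
rewrite itv_nbhsE; case: n => [|n].
  exists `]-oo, Some 1%N : omega1_top[; first by split; rewrite //= in_itv /= lt.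
  move=> [[|n]|] //=; rewrite in_itv /=.
  by rewrite lt.
exists `]Some n : omega1_top, Some n.+2 : omega1_top[.
  by split; rewrite //= in_itv /= !lt !ltnSn.
move=> [m|] /=; rewrite in_itv /= ?lt.
  by move=> /andP[nm mn]; congr Some; apply/eqP; rewrite eqn_leq -ltnS mn.
by move=> /andP[].
Qed.

End omega1_topology.

Section C_omega1.
Variable R : realType.
Local Notation K := (Cplx R).
Local Notation C := (C_omega1 R).

Lemma omega1_continuous (f : omega1_top -> K) :
  (exists N, forall n, (N <= n)%N -> f (Some n) = f None) -> continuous f.
Proof.
move=> [N HN] x.
have fx : nbhs x [set y | f y = f x].
  case: x => [n|]; first by apply: filterS (nbhs_finite_ordinal n) => y ->.
  by apply: (nbhs_omega [set y | f y = f None]).2; exists N => -[n /HN|].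
by apply: (@cvg_near_cst _ _ (f x) f (nbhs x)) fx.
Qed.

Lemma ctsC_near_omega (f : C) (e : K) : 0 < e ->
  exists N, forall n, (N <= n)%N -> `|ctsC_fun f None - ctsC_fun f (Some n)| < e.
Proof.
move=> e0; have /cvgrPdist_lt/(_ e e0) fe := @ctsC_continuous _ _ _ f (None : omega1_top).
have [N HN] := (nbhs_omega _).1 fe.
by exists N => n Nn; exact: (HN (Some n)).
Qed.

(* The points of omega + 1, numbered as in gen_at. *)
Definition omega1_index (x : omega1_top) : nat := if x is Some n then n.+1 else 0%N.
Definition omega1_point (n : nat) : omega1_top := if n is n'.+1 then Some n' else None.

Lemma omega1_pointK : cancel omega1_point omega1_index. Proof. by case. Qed.
Lemma omega1_indexK : cancel omega1_index omega1_point. Proof. by case. Qed.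

Lemma indicator_continuous (b : nat -> bool) :
  (exists N, forall n, (N <= n)%N -> b n = b 0%N) ->
  continuous (fun x => (b (omega1_index x))%:R : K).
Proof.
move=> [N HN]; apply: omega1_continuous; exists N => n Nn /=.
by rewrite HN // leqW.
Qed.

Lemma singleton_eventually k : (0 < k)%N -> exists N, forall n, (N <= n)%N ->
  (n == k) = (0%N == k).
Proof. by move=> k0; exists k.+1 => n kn; rewrite gtn_eqF // ltn_eqF. Qed.

Definition chi k (k0 : (0 < k)%N) : C :=
  mkctsC (indicator_continuous (singleton_eventually k0)).

Lemma chiE k (k0 : (0 < k)%N) x : ctsC_fun (chi k0) x = (omega1_index x == k)%:R.
Proof. by []. Qed.

Lemma ctsC_sumE (I : Type) (s : seq I) (F : I -> C) x :
  ctsC_fun (\sum_(i <- s) F i) x = \sum_(i <- s) ctsC_fun (F i) x.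
Proof. exact: (big_morph (fun f : C => ctsC_fun f x : K)). Qed.

End C_omega1.

(** * Presentations of the algebra of continuous functions *)

Section C_omega1_presentation.
Variable R : realType.
Local Notation K := (Cplx R).
Local Notation C := (C_omega1 R).
Variable en : nat -> nat.
Hypothesis en_inj : forall s t, (0 < en s)%N -> en s = en t -> s = t.

Definition gen_cts j : C :=
  mkctsC (indicator_continuous (gen_at_eventually j en_inj)).

Lemma gen_ctsE j x : ctsC_fun (gen_cts j) x = (gen_at en j (omega1_index x))%:R.
Proof. by []. Qed.

Lemma chi_in_subalgebra (B : set C) k (k0 : (0 < k)%N) :
  star_subalgebra B -> (forall j, B (gen_cts j)) -> B (chi R k0).
Proof.
move=> [B0 BD BZ _ _] Bg.
have [H|[m [m0 mk Hk Hm]]] := gen_at_split en_inj k0.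
  rewrite (_ : chi R k0 = gen_cts k) //; apply: ctsCP => x.
  by rewrite chiE gen_ctsE H.
rewrite (_ : chi R k0 = gen_cts k + (-1) *: gen_cts m); first exact/BD/BZ.
apply: ctsCP => x; rewrite chiE.
change ((omega1_index x == k)%:R = ctsC_fun (gen_cts k) x + (-1) * ctsC_fun (gen_cts m) x).
rewrite !gen_ctsE Hk Hm mulN1r.
case: (eqVneq (omega1_index x) m) mk => [->|]; rewrite ?orbF ?subr0 //.
by move=> /negPf ->; rewrite subrr.
Qed.

Lemma gen_cts_dense : dense (smallest (@star_subalgebra K C) (range gen_cts)).
Proof.
move=> O [f Of] oO.
have /nbhs_ballP[e /= e0 eO] : nbhs f O by exact: open_nbhs_nbhs.
have e20 : 0 < e / 2 by rewrite divr_gt0.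
have [N HN] := ctsC_near_omega f e20.
(* [g] agrees with [f] at omega and below [N], and keeps the value of [f] at omega from [N] on. *)
pose g : C := ctsC_fun f None *: gen_cts 0 +
  \sum_(i < N) (ctsC_fun f (Some (i : nat)) - ctsC_fun f None) *: chi R (ltn0Sn i).
exists g; split; last first.
  move=> B [subB rB].
  have Bg j : B (gen_cts j) by apply: rB; exists j.
  have [B0 BD BZ _ _] := subB; apply: (BD); first exact: BZ.
  by apply: big_ind => // i _; apply: BZ; exact: chi_in_subalgebra.
apply: eO; rewrite -ball_normE /ball_ /=.
apply: (@le_lt_trans _ _ (e / 2)); last by rewrite ltr_pdivrMr // ltr_pMr // ltr1n.
apply: ctsC_norm_le => [|x]; first exact: ltW.
have gE : ctsC_fun g x = ctsC_fun f None +
    \sum_(i < N) (ctsC_fun f (Some (i : nat)) - ctsC_fun f None) * (omega1_index x == i.+1)%:R.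
  rewrite -[LHS]/(ctsC_fun f None * ctsC_fun (gen_cts 0) x + ctsC_fun (\sum_(i < N)
    (ctsC_fun f (Some (i : nat)) - ctsC_fun f None) *: chi R (ltn0Sn i) : C) x).
  by rewrite gen_ctsE mulr1 ctsC_sumE.
change (`|ctsC_fun f x - ctsC_fun g x| <= e / 2); rewrite gE; case: x {gE} => [n|] /=; last first.
  by rewrite big1 ?addr0 ?subrr ?normr0 ?ltW // => i _; rewrite mulr0.
have [Nn|nN] := leqP N n.
  rewrite big1 ?addr0; last first.
    move=> i _; rewrite (_ : (n.+1 == i.+1) = false) ?mulr0 //.
    by rewrite eqSS gtn_eqF // (leq_trans _ Nn).
  by rewrite distrC ltW // HN.
rewrite (bigD1 (Ordinal nN)) //= eqxx mulr1 big1 ?addr0 => [|i].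
  by rewrite addrCA subrr addr0 subrr normr0 ltW.
by move/negPf => ni; rewrite eqSS eq_sym -[_ == _]/(i == Ordinal nN) ni mulr0.
Qed.

Definition C_omega1_presentation : cstar_presentation C := CStarPresentation gen_cts_dense.
Local Notation P := C_omega1_presentation.

Lemma word_valE w x : ctsC_fun (word_val P w) x = (word_at en (omega1_index x) w)%:R.
Proof.
have letE l : ctsC_fun (letter_val P l) x = (gen_at en l.1 (omega1_index x))%:R.
  case: l => j [] //; rewrite /letter_val /=.
  change ((ctsC_fun (gen_cts j) x)^* = (gen_at en j (omega1_index x))%:R :> K).
  by rewrite gen_ctsE rmorph_nat.
case: w => l s; rewrite /word_val /word_at /=.
have : ctsC_fun (letter_val P l) x = (gen_at en l.1 (omega1_index x))%:R by exact: letE.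
elim: s (letter_val P l) (gen_at en l.1 _) => [|m s IH] y b yE /=; first by rewrite andbT.
rewrite (IH _ (b && gen_at en m.1 (omega1_index x))) ?andbA //.
change (ctsC_fun y x * ctsC_fun (letter_val P m) x = (b && gen_at en m.1 (omega1_index x))%:R :> K).
by rewrite yE letE -natrM mulnb.
Qed.

Definition state_val (s : nat * ((nat * nat) * (nat * nat))) : K :=
  ((s.2.1.1%:R - s.2.1.2%:R) + 'i * (s.2.2.1%:R - s.2.2.2%:R)) / s.1%:R.

Lemma fraction_valE (q : rational_code) :
  fraction_val q = ((int_pos q.1)%:R - (int_neg q.1)%:R) / q.2.+1%:R :> K.
Proof. by rewrite /fraction_val {1}(int_posneg q.1) rmorphB. Qed.

Lemma poly_at_den_gt0 n p : (0 < (poly_at en n p).1)%N.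
Proof.
rewrite /poly_at; have : (0 < (1, ((0, 0), (0, 0)) : (nat * nat) * (nat * nat)).1)%N by [].
elim: p (1%N, _) => //= t p IH s s0; apply: IH.
by rewrite /= muln_gt0 s0 /monomial_den muln_gt0.
Qed.

Lemma gen_pointE p x : ctsC_fun (gen_point P p) x = state_val (poly_at en (omega1_index x) p).
Proof.
rewrite /gen_point ctsC_sumE /poly_at.
set s0 := (1%N, _); have : (0 < s0.1)%N by [].
have : state_val s0 = 0 by rewrite /state_val /= !subrr mulr0 addr0 mul0r.
move=> s0v; rewrite -[LHS]add0r -{1}s0v {s0v}.
elim: p s0 => [|t p IH] s s0 /=; first by rewrite big_nil addr0.
rewrite big_cons addrA -IH; last by rewrite /= muln_gt0 s0 /monomial_den muln_gt0.
congr (_ + _); rewrite -[X in _ + X]/((fraction_val t.1.1 + 'i * fraction_val t.1.2) *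
  ctsC_fun (word_val P t.2) x).
rewrite word_valE !fraction_valE /state_val /poly_step /monomial_den /=.
rewrite !natrD !natrM.
have s0' : s.1%:R != 0 :> K by rewrite pnatr_eq0 -lt0n.
have d1 : t.1.1.2.+1%:R != 0 :> K by rewrite pnatr_eq0.
have d2 : t.1.2.2.+1%:R != 0 :> K by rewrite pnatr_eq0.
move: s0' d1 d2; move: (s.1%:R : K) (t.1.1.2.+1%:R : K) (t.1.2.2.+1%:R : K).
by move=> a d1 d2 a0 d10 d20; field; rewrite ?a0 ?d10 ?d20.
Qed.

Lemma poly_at_den n p : (poly_at en n p).1 = (poly_at en 0 p).1.
Proof.
rewrite /poly_at; set s0 := (1%N, _).
suff : forall s s' : nat * ((nat * nat) * (nat * nat)), s.1 = s'.1 ->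
    (foldl (poly_step en n) s p).1 = (foldl (poly_step en 0) s' p).1 by apply.
by elim: p {s0} => //= t p IH s s' E; apply: IH; rewrite /= E.
Qed.

Lemma sqnorm_state_val s :
  `|state_val s| ^+ 2 = (sqnorm_num s)%:R / s.1%:R ^+ 2.
Proof.
rewrite /state_val normrM normfV exprMn exprVn normr_nat; congr (_ / _).
have re (m n : nat) : (m%:R - n%:R : K) \is Num.real by rewrite realB ?realn.
rewrite normC2_rect // /sqnorm_num natrD !natrX.
have sq (m n : nat) : ((m - n + (n - m))%:R : K) ^+ 2 = (m%:R - n%:R) ^+ 2.
  have [mn|/ltnW mn] := leqP m n.
    rewrite (eqP (_ : m - n == 0)%N) ?subn_eq0 // add0n natrB //.
    by rewrite -sqrrN opprB.
  by rewrite (eqP (_ : n - m == 0)%N) ?subn_eq0 // addn0 natrB.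
by rewrite !sq.
Qed.

(** All values of a generated point are taken at the points up to [code p], so the supremum is a
    maximum over these; squaring keeps it rational. *)
Lemma sqnorm_gen_point p :
  `|gen_point P p| ^+ 2 = (max_sqnorm_num en p)%:R / (poly_at en 0 p).1%:R ^+ 2 :> K.
Proof.
have [[m mb] mE] : exists m : 'I_(code p).+1,
    max_sqnorm_num en p = sqnorm_num (poly_at en m p).
  have [|m mE] := @bigop.eq_bigmax _ (fun m : 'I_(code p).+1 => sqnorm_num (poly_at en m p)).
    by rewrite card_ord.
  by exists m.
have sqE x : `|ctsC_fun (gen_point P p) x| ^+ 2 =
    (sqnorm_num (poly_at en (omega1_index x) p))%:R / (poly_at en 0 p).1%:R ^+ 2.
  by rewrite gen_pointE sqnorm_state_val poly_at_den.
suff -> : `|gen_point P p| = `|ctsC_fun (gen_point P p) (omega1_point m)|.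
  by rewrite sqE omega1_pointK mE.
apply/eqP; rewrite eq_le ctsC_norm_ge andbT; apply: ctsC_norm_le => // x.
rewrite -(@ler_pXn2r _ 2) ?nnegrE // !sqE omega1_pointK -mE.
rewrite ler_wpM2r ?invr_ge0 ?exprn_ge0 // ler_nat.
have [k kb ->] := poly_at_bounded en (omega1_index x) p.
exact: (leq_bigmax (Ordinal kb)).
Qed.

Lemma C_omega1_presentation_computable : computable en -> computable_presentation P.
Proof.
move=> Hen; have [r [Hr rP]] := computable_sqrt.
have HM := computable_max_sqnorm_num Hen; have Hp := computable_poly_at Hen.
have Hd : computable (fun p : seq monomial => poly_at en 0 p).
  by apply: (computable_comp (f := fun p : seq monomial => (0%N, p)) Hp); computability.
(* The norm is [v = sqrt M / d]. The numerator is the integer part of [v * 2^k * d], so the error is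
   below [1 / (2^k * d)]; the denominator is stored less one. *)
exists (fun x => (Posz (r (max_sqnorm_num en x.1 * (2 ^ x.2 * 2 ^ x.2))%N),
  (2 ^ x.2 * (poly_at en 0 x.1).1)%N.-1)); split.
  by computability.
move=> p k /=; set M := max_sqnorm_num en p; set d := (poly_at en 0 p).1.
set v := `|gen_point P p|; set q := (2 ^ k)%N.
have d0 : (0 < d)%N by exact: poly_at_den_gt0.
have q0 : (0 < q)%N by rewrite expn_gt0.
have qd0 : 0 < (q * d)%:R :> K by rewrite ltr0n muln_gt0 q0.
have vE : (v * (q * d)%:R) ^+ 2 = (M * (q * q))%:R.
  rewrite exprMn sqnorm_gen_point -/M -/d !natrM.
  by field; rewrite pnatr_eq0 -lt0n.
have v0 : 0 <= v * (q * d)%:R by apply: mulr_ge0; [exact: normr_ge0|exact: ltW].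
have /andP[r1 r2] := rP (M * (q * q))%N; set n := r _ in r1 r2 *.
have n1 : n%:R <= v * (q * d)%:R.
  by rewrite -(@ler_pXn2r _ 2) ?nnegrE ?ler0n // vE -natrX ler_nat.
have n2 : v * (q * d)%:R < n.+1%:R.
  by rewrite -(@ltr_pXn2r _ 2) ?nnegrE ?ler0n // vE -natrX ltr_nat.
rewrite fraction_valE /= subr0 prednK ?muln_gt0 ?q0 //.
rewrite -(@ltr_pM2r _ (q * d)%:R) // -{2}(gtr0_norm qd0) -normrM mulrBl divfK ?gt_eqF //.
rewrite ler0_norm ?subr_le0 // opprB.
apply: (@lt_le_trans _ _ 1); first by rewrite ltrBlDr addrC natr1.
rewrite natrM mulrA -natrX mulVf ?mul1r ?ler1n // pnatr_eq0 -lt0n //.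
Qed.

End C_omega1_presentation.

(** * Minimal projections *)

Section minimal_projections.

(** In [C_omega1] the idempotents are the continuous functions with values 0 and 1, which are
    self-adjoint, and [cmul p q = q] says that [q] lies below [p]. *)
Definition minimal_projection (K : numClosedFieldType) (A : cstarAlgType K) (p : A) : Prop :=
  [/\ cmul p p = p, p <> 0 &
    forall q, cmul q q = q -> cmul p q = q -> q = 0 \/ q = p].

Lemma star_isomorphism_inverse (K : numClosedFieldType) (A B : cstarAlgType K)
    (phi : A -> B) : star_isomorphism phi ->
  exists psi : B -> A, star_isomorphism psi /\ cancel phi psi.
Proof.
move=> [[psi phiK psiK] lin mul st]; exists psi; split=> //.
have inj := can_inj phiK; split=> [|a x y|x y|x]; first by exists phi.
- by apply: inj; rewrite lin !psiK.
- by apply: inj; rewrite mul !psiK.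
- by apply: inj; rewrite st !psiK.
Qed.

Lemma minimal_projection_preimage (K : numClosedFieldType) (A B : cstarAlgType K)
    (phi : A -> B) p :
  star_isomorphism phi -> minimal_projection (phi p) -> minimal_projection p.
Proof.
move=> [bij lin mul _] [pp p0 min]; have inj := bij_inj bij.
have phi0 : phi 0 = 0.
  by apply: (addrI (phi 0)); have := lin 1 0 0; rewrite !scale1r !addr0.
split=> [||q qq pq]; first by apply: inj; rewrite mul.
  by move=> E; apply: p0; rewrite E.
have [||E|E] := min (phi q); rewrite -?mul ?qq ?pq //.
  by left; apply: inj; rewrite phi0.
by right; exact: inj.
Qed.

Variable R : realType.
Local Notation K := (Cplx R).
Local Notation C := (C_omega1 R).

Lemma ctsC_idempotent (f : C) x : cmul f f = f ->
  ctsC_fun f x = 0 \/ ctsC_fun f x = 1.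
Proof.
move=> ff; have : ctsC_fun f x * ctsC_fun f x = ctsC_fun f x.
  exact: (congr1 (fun g : C => ctsC_fun g x) ff).
have [->|f0] := eqVneq (ctsC_fun f x) 0; first by left.
by rewrite -[RHS]mulr1 => /(mulfI f0); right.
Qed.

Lemma minimal_projection_chi k (k0 : (0 < k)%N) : minimal_projection (chi R k0).
Proof.
split=> [||q qq pq].
- apply: ctsCP => x; change (ctsC_fun (chi R k0) x * ctsC_fun (chi R k0) x = ctsC_fun (chi R k0) x).
  by rewrite chiE -natrM mulnb andbb.
- move=> /(congr1 (fun g : C => ctsC_fun g (omega1_point k))).
  change (ctsC_fun (chi R k0) (omega1_point k) = 0 -> False).
  by rewrite chiE omega1_pointK eqxx => /eqP; rewrite oner_eq0.
have qE x : ctsC_fun q x = (omega1_index x == k)%:R * ctsC_fun q (omega1_point k).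
  rewrite -{1}pq; change (ctsC_fun (chi R k0) x * ctsC_fun q x = 
    (omega1_index x == k)%:R * ctsC_fun q (omega1_point k)).
  by rewrite chiE; case: eqP => [<-|]; rewrite ?mul0r // omega1_indexK.
have [q0|q1] := ctsC_idempotent (omega1_point k) qq; [left|right]; apply: ctsCP => x.
  by rewrite qE q0 mulr0.
by rewrite qE q1 mulr1.
Qed.

Lemma minimal_projectionP (p : C) : minimal_projection p ->
  exists n, p = chi R (ltn0Sn n).
Proof.
move=> [pp p0 min]; have [n pn] : exists n, ctsC_fun p (Some n) = 1.
  have [[n|] pn] : exists x, ctsC_fun p x = 1.
  - apply: contrapT => N; apply: p0; apply: ctsCP => x.
    by case: (ctsC_idempotent x pp) => // px; case: N; exists x.
  - by exists n.
  (* If [p] is 1 at omega, continuity makes its values near omega nonzero, hence 1. *)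
  have [N HN] := @ctsC_near_omega R p 1 ltr01; exists N.
  have := HN N (leqnn N); rewrite pn.
  by case: (ctsC_idempotent (Some N : omega1_top) pp) => // ->; rewrite subr0 normr1 ltxx.
exists n; case: (min (chi R (ltn0Sn n))) => //.
- by have [] := minimal_projection_chi (ltn0Sn n).
- apply: ctsCP => x; change (ctsC_fun p x * ctsC_fun (chi R (ltn0Sn n)) x =
    ctsC_fun (chi R (ltn0Sn n)) x).
  rewrite chiE; case: eqP => [E|_]; last by rewrite mulr0.
  by rewrite -(omega1_indexK x) E /= pn mulr1.
- by move=> E; have [_ []] := minimal_projection_chi (ltn0Sn n).
Qed.

(** Values in {0, 1} at distance less than 1 coincide. This turns approximations into exact
    decisions. *)
Lemma idempotent_close (f g : C) : cmul f f = f -> cmul g g = g -> `|f - g| < 1 -> f = g.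
Proof.
move=> ff gg fg; apply: ctsCP => x.
have : `|ctsC_fun f x - ctsC_fun g x| < 1 by apply: le_lt_trans (ctsC_norm_ge (f - g) x) fg.
case: (ctsC_idempotent x ff) => ->; case: (ctsC_idempotent x gg) => ->; rewrite // ?sub0r ?subr0.
  by rewrite normrN1 ltxx.
by rewrite normr1 ltxx.
Qed.

Variable en : nat -> nat.
Hypothesis en_inj : forall s t, (0 < en s)%N -> en s = en t -> s = t.

Lemma gen_cts_idempotent j : cmul (gen_cts R en_inj j) (gen_cts R en_inj j) = gen_cts R en_inj j.
Proof.
apply: ctsCP => x; change (ctsC_fun (gen_cts R en_inj j) x * ctsC_fun (gen_cts R en_inj j) x
  = ctsC_fun (gen_cts R en_inj j) x).
by rewrite gen_ctsE -natrM mulnb andbb.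
Qed.

Lemma gen_cts_minimal e : ~ (exists s, en s = e.+1) ->
  minimal_projection (gen_cts R en_inj e.*2.+1).
Proof.
move=> N; rewrite (_ : gen_cts _ _ _ = chi R (ltn0Sn e.*2)).
  exact: minimal_projection_chi.
by apply: ctsCP => x; rewrite gen_ctsE chiE gen_at_not_enumerated.
Qed.

Lemma gen_cts_not_minimal e : (exists s, en s = e.+1) ->
  ~ minimal_projection (gen_cts R en_inj e.*2.+1).
Proof.
move=> [s Es] /minimal_projectionP[n E]; have [g1 g2] := gen_at_odd_enumerated Es.
have H k : gen_at en e.*2.+1 k -> k = n.+1.
  move=> gk; have /(congr1 (fun g : C => ctsC_fun g (omega1_point k))) := E.
  change (ctsC_fun (gen_cts R en_inj e.*2.+1) (omega1_point k) =
    ctsC_fun (chi R (ltn0Sn n)) (omega1_point k) -> k = n.+1).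
  rewrite gen_ctsE chiE omega1_pointK gk.
  by case: eqP => // _ /eqP; rewrite oner_eq0.
have : e.*2.+1 = s.*2.+2 by rewrite (H _ g1) (H _ g2).
by move/(congr1 odd); rewrite /= !odd_double.
Qed.

End minimal_projections.

(** * Comparison of the two presentations of the algebra *)

Section not_isomorphic.
Variables (R : realType) (en : nat -> nat).
Hypothesis en_inj : forall s t, (0 < en s)%N -> en s = en t -> s = t.
Local Notation K := (Cplx R).
Local Notation C := (C_omega1 R).
Local Notation P := (C_omega1_presentation R en_inj).
Local Notation Q := (C_omega1_presentation R no_enumeration_inj).

Definition letter_monomial (c : int) (j : nat) : monomial :=
  (((c, 0%N), (Posz 0, 0%N)), ((j, false), [::])).

Lemma gen_point_cons (D : cstar_presentation C) c j p :
  gen_point D (letter_monomial c j :: p) = c%:~R *: special D j + gen_point D p.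
Proof.
rewrite /gen_point big_cons; congr (_ *: _ + _).
by rewrite /fraction_val /= !divr1 mulr0 addr0.
Qed.

(** The comparison becomes a test on natural numbers; a negative numerator has positive part 0 and
    passes it. *)
Lemma fraction_val_lt_half (q : rational_code) :
  ((int_pos q.1).*2 < q.2.+1)%N = (fraction_val q < 2^-1 :> K).
Proof.
have q0 : 0 < q.2.+1%:R :> K by rewrite ltr0n.
rewrite /fraction_val ltr_pdivrMr // mulrC ltr_pdivlMr //; case: q.1 => n /=.
  by rewrite -[n%:~R]/(n%:R) -natrM ltr_nat muln2.
rewrite NegzE mulrNz mulNr; symmetry; apply: le_lt_trans q0.
by rewrite oppr_le0 mulr_ge0 ?ler0n.
Qed.

Lemma C_omega1_presentations_not_isomorphic : computable en ->
  ~ computable_pred (fun e => exists s, en s = e.+1) ->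
  ~ computably_star_isomorphic P Q.
Proof.
move=> Hen undec [phi [iso [f [Hf fP]]]]; apply: undec.
have [bij lin mul _] := iso.
have [N [HN NP]] := C_omega1_presentation_computable R no_enumeration_inj
  (@computable_cst nat _ nat _ 0%N).
pose y e := gen_cts R en_inj e.*2.+1.
pose g e := f ([:: letter_monomial 1 e.*2.+1], 2%N).
pose test e m := N (letter_monomial (-1) m.+1 :: g e, 2%N).
have gP e : `|gen_point Q (g e) - phi (y e)| < 2 ^- 2.
  have := fP [:: letter_monomial 1 e.*2.+1] 2%N.
  by rewrite gen_point_cons /gen_point big_nil scale1r addr0.
have XE m : special Q m.+1 = chi R (ltn0Sn m).
  by apply: ctsCP => x; rewrite gen_ctsE gen_at_none chiE /= eq_sym.
have testP e m : `|fraction_val (test e m) - `|gen_point Q (g e) - chi R (ltn0Sn m)| | < 2 ^- 2.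
  have := NP (letter_monomial (-1) m.+1 :: g e) 2%N.
  by rewrite gen_point_cons XE mulrN1z scaleN1r (addrC (- chi R _)).
have half2 : 2 ^- 2 + 2 ^- 2 = 2^-1 :> K by field.
have sum1 : 2 ^- 2 + (2^-1 + 2 ^- 2) = 1 :> K by field.
have fracR (q : rational_code) : fraction_val q \is @Num.real K.
  by rewrite /fraction_val realM ?realV ?realn ?realz.
(* Both the name of [phi (y e)] and the computed norm are accurate to within 1/4. Equality gives a
   result below 1/4 + 1/4; a result below 1/2 bounds the distance strictly by 1/4 + 1/2 + 1/4 = 1,
   and idempotents that close are equal. *)
have test_chi e m : (fraction_val (test e m) < 2^-1 :> K) <-> phi (y e) = chi R (ltn0Sn m).
  have := testP e m; rewrite real_ltr_distl; last by rewrite realB ?fracR ?normr_real.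
  move=> /andP[t1 t2].
  split=> [lt|E]; last first.
    by apply: lt_trans t2 _; rewrite -half2 ltrD2r -E.
  apply: idempotent_close.
  - by rewrite -mul gen_cts_idempotent.
  - by have [] := minimal_projection_chi R (ltn0Sn m).
  rewrite -(subrKA (gen_point Q (g e))) -sum1.
  apply: le_lt_trans (ler_normD _ _) _; rewrite distrC; apply: ltrD => //.
  by move: t1; rewrite ltrBlDr => /lt_trans; apply; rewrite ltrD2r.
pose T e m := (en m == e.+1) || ((int_pos (test e m).1).*2 < (test e m).2.+1)%N.
have [||m [Hm mP]] := @computable_mu nat _ T.
- by rewrite /T /test /g /letter_monomial; computability.
- move=> e; have [[s Es]|Ne] := pselect (exists s, en s = e.+1).
    by exists s; rewrite /T Es eqxx.
  have [psi [isopsi psiK]] := star_isomorphism_inverse iso.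
  have [n En] : exists n, phi (y e) = chi R (ltn0Sn n).
    apply: minimal_projectionP; apply: (minimal_projection_preimage isopsi).
    by rewrite psiK; exact: gen_cts_minimal.
  by exists n; rewrite /T fraction_val_lt_half; apply/orP; right; apply/test_chi.
(* For an enumerated [e] the image is no minimal projection, hence no [chi], and the search must
   have found the stage. *)
apply: (computable_ext (f := fun e => en (m e) == e.+1)); first by computability.
move=> e; apply/eqP/asboolP => [E|W]; first by exists (m e).
have := mP e; rewrite /T fraction_val_lt_half => /orP[/eqP//|/test_chi E].
case: (gen_cts_not_minimal (en_inj := en_inj) (R := R) W).
apply: (minimal_projection_preimage iso); rewrite -/(y e) E.
exact: minimal_projection_chi.
Qed.

End not_isomorphic.

Theorem corollary10p3 (R : realType) :
  (exists P Q : cstar_presentation (C_omega1 R),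
    [/\ computable_presentation P, computable_presentation Q &
        ~ computably_star_isomorphic P Q]) /\
  (exists G : unitalGroup, dimension_group G /\
    exists nu mu : group_presentation G,
      [/\ ce_presentation nu, ce_presentation mu &
          ~ computably_group_isomorphic nu mu]) /\
  (exists D D' : bratteli,
    [/\ computably_presentable D, computably_presentable D',
        diagram_equivalent D D' & ~ diagram_computably_equivalent D D']).
Proof.
have [en [Hen en_inj en_even undec]] := undecidable_enumeration.
have H0 := @computable_cst nat _ nat _ 0%N.
split; last split.
- exists (C_omega1_presentation R en_inj), (C_omega1_presentation R no_enumeration_inj).
  split; [exact: C_omega1_presentation_computable..|].
  exact: C_omega1_presentations_not_isomorphic.
- exists unital_seq_group; split; first exact: seq_group_dimension.
  exists (seq_group_presentation en_inj), (seq_group_presentation no_enumeration_inj).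
  split; [exact: seq_group_presentation_ce..|].
  exact: seq_group_presentations_not_isomorphic.
- exists (strands en), (strands (fun=> 0%N)).
  split; [exact: strands_computably_presentable..| |].
    exact: strands_equivalent.
  exact: strands_not_computably_equivalent.
Qed.
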